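(* Let $R$ be an associative ring with $1$, let $\mathcal A$ be a set of finitely presented left $R$-modules, let $\mathcal B=\mathrm{add}(\mathcal A)$ and let $\mathcal C=\varinjlim\mathcal B$ be the class of all direct limits of modules from $\mathcal B$. Let $F_{\mathcal A}=\bigoplus_{A\in\mathcal A}A^{(\omega)}$ and let $T_{\mathcal A}$ be the complete first-order theory of $F_{\mathcal A}$. Suppose $\Phi$ is a descending chain $\varphi_0\ge\varphi_1\ge\varphi_2\ge\dots$ of pp formulas of fixed arity in $\Gamma_{\mathcal B}$ and $B_\Phi$ is the corresponding Bass module. \begin{itemize} \item[(1)] $F_{\mathcal A}\oplus B_\Phi$ is a model of $T_{\mathcal A}$. \item[(2)] If the chain $\Phi$ does not stabilize, then $F_{\mathcal A}\oplus B_\Phi$ is a $\mathcal C$-model that is not Mittag-Leffler, hence not pure-projective either. \end{itemize}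
   Context: All modules are unitary left $R$-modules; $R\text{-Mod}$ is the class of all of them, $R\text{-mod}$ the class of all finitely presented ones. For a class $\mathcal K$ of modules, $\mathrm{Add}(\mathcal K)$ (resp. $\mathrm{add}(\mathcal K)$) is the class of all direct summands of direct sums (resp. of finite direct sums) of modules from $\mathcal K$. A module is pure-projective if it lies in $\mathrm{Add}(R\text{-mod})$. $M^{(\omega)}$ denotes the direct sum of countably infinitely many copies of $M$. Modules are first-order structures in the language $L$ with $0$, $+$ and a unary function symbol for each $r\in R$. A positive primitive (pp) formula in variables $\bar x$ is one of the form $\exists\bar y\,(A\bar y=B\bar x)$ with $A,B$ matrices over $R$ of matching sizes. For pp formulas of the same arity, $\varphi\le\psi$ means $\varphi(M)\subseteq\psi(M)$ for every $M\in R\text{-Mod}$. The pp type $\mathrm{pp}_M(\bar a)$ of a finite tuple $\bar a$ in $M$ is the set of all pp formulas satisfied by $\bar a$ in $M$. A formula $\varphi$ generates $\mathrm{pp}_M(\bar a)$ if $\varphi\in\mathrm{pp}_M(\bar a)$ and $\varphi\le\psi$ for every $\psi\in\mathrm{pp}_M(\bar a)$; the pp type is finitely generated if some pp formula generates it. A module is Mittag-Leffler if and only if the pp type of every finite tuple in it is finitely generated. $\Gamma_{\mathcal B}$ is the set of all pp formulas (of any arity) that generate the pp type of some tuple in some module from $\mathcal B$; equivalently (as $\mathcal B\subseteq R\text{-mod}$), those that have a free realization $(M,\bar a)$ with $M\in\mathcal B$. Here $(M,\bar a)$ is a free realization of $\varphi$ if $\bar a$ satisfies $\varphi$ in $M$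 and for every module $N$ and every tuple $\bar b$ satisfying $\varphi$ in $N$ there is a homomorphism $M\to N$ sending $\bar a$ to $\bar b$. A Bass module $B_\Phi$ for a descending chain $\Phi$ of pp formulas $\varphi_0\ge\varphi_1\ge\varphi_2\ge\dots$ of fixed arity is obtained as follows: choose finitely presented free realizations $(A_i,\bar a_i)$ of $\varphi_i$ and homomorphisms $g_i:A_i\to A_{i+1}$ with $g_i(\bar a_i)=\bar a_{i+1}$, for all $i<\omega$ (these exist because $\bar a_{i+1}$ satisfies $\varphi_i$ in $A_{i+1}$); $B_\Phi$ is the direct limit of the chain $A_0\to A_1\to A_2\to\dots$ along the $g_i$. The choice is by no means unique. The chain $\Phi$ stabilizes if (uniformly in $R\text{-Mod}$) there is $n$ such that $\varphi_i(M)=\varphi_n(M)$ for all $i\ge n$ and all modules $M$. A $\mathcal C$-model is a module that is a model of $T_{\mathcal A}$ and at the same time a member of $\mathcal C$.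
   Formalization: The free realizations A_i used to build the Bass module B_Φ are required to lie in 𝓑 = add(𝒜), not merely to be finitely presented; for arbitrary finitely presented choices the claim fails (𝒜 = {0}, φ_i: x = 0, A_i = N ≠ 0 with tuple 0). *)

(* Defs.v *)
From HB Require Import structures.
From mathcomp Require Import all_boot all_order all_algebra.
From mathcomp Require Import all_classical.
Set Implicit Arguments.
Unset Strict Implicit.
Unset Printing Implicit Defensive.
Import GRing.Theory.
Local Open Scope ring_scope.

(* The carriers of infinite products and sums get their choice structure from
   the classical axioms of boolp. *)
Section DirectProduct.
Variables (R : pzRingType) (I : Type) (M : I -> lmodType R).

Definition dprod : Type := forall i, M i.
HB.instance Definition _ := gen_eqMixin dprod.
HB.instance Definition _ := gen_choiceMixin dprod.

Definition dprod_zero : dprod := fun=> 0.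
Definition dprod_opp (f : dprod) : dprod := fun i => - f i.
Definition dprod_add (f g : dprod) : dprod := fun i => f i + g i.
Definition dprod_scale (r : R) (f : dprod) : dprod := fun i => r *: f i.

Fact dprod_addA : associative dprod_add.
Proof. by move=> f g h; apply: functional_extensionality_dep => i; exact: addrA. Qed.
Fact dprod_addC : commutative dprod_add.
Proof. by move=> f g; apply: functional_extensionality_dep => i; exact: addrC. Qed.
Fact dprod_add0 : left_id dprod_zero dprod_add.
Proof. by move=> f; apply: functional_extensionality_dep => i; exact: add0r. Qed.
Fact dprod_addN : left_inverse dprod_zero dprod_opp dprod_add.
Proof. by move=> f; apply: functional_extensionality_dep => i; exact: addNr. Qed.
HB.instance Definition _ :=
  GRing.isZmodule.Build dprod dprod_addA dprod_addC dprod_add0 dprod_addN.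

Fact dprod_scaleA r s f : dprod_scale r (dprod_scale s f) = dprod_scale (r * s) f.
Proof. by apply: functional_extensionality_dep => i; exact: scalerA. Qed.
Fact dprod_scale1 : left_id 1 dprod_scale.
Proof. by move=> f; apply: functional_extensionality_dep => i; exact: scale1r. Qed.
Fact dprod_scaleDr : right_distributive dprod_scale +%R.
Proof. by move=> r f g; apply: functional_extensionality_dep => i; exact: scalerDr. Qed.
Fact dprod_scaleDl f : {morph dprod_scale^~ f : r s / r + s}.
Proof. by move=> r s; apply: functional_extensionality_dep => i; exact: scalerDl. Qed.
HB.instance Definition _ := GRing.Zmodule_isLmodule.Build R dprod
  dprod_scaleA dprod_scale1 dprod_scaleDr dprod_scaleDl.

End DirectProduct.

Section DirectSum.
Variables (R : pzRingType) (I : Type) (M : I -> lmodType R).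

Definition finsupp : {pred dprod M} :=
  fun f => `[< finite_set [set i | f i <> 0]%classic >].

Fact finsupp_submod_closed : submod_closed finsupp.
Proof.
split.
  apply/asboolP; apply: sub_finite_set (finite_set0 I) => i /=.
  by apply.
move=> r f g /asboolP finf /asboolP fing; apply/asboolP.
apply: sub_finite_set (_ : finite_set ([set i | f i <> 0] `|` [set i | g i <> 0])%classic).
  move=> i /= fgi; have [fi0|] := pselect (f i = 0); last by left.
  right=> gi0; apply: fgi.
  by rewrite -[LHS]/(r *: f i + g i) fi0 gi0 scaler0 addr0.
by rewrite finite_setU.
Qed.
HB.instance Definition _ :=
  GRing.isSubmodClosed.Build R (dprod M) finsupp
    finsupp_submod_closed.

Record dsum : Type := DSum { dsum_val :> dprod M; _ : dsum_val \in finsupp }.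
HB.instance Definition _ := [isSub for dsum_val].
HB.instance Definition _ := [Choice of dsum by <:].
HB.instance Definition _ := [SubChoice_isSubLmodule of dsum by <:].

End DirectSum.

Section Modules.
Variable R : pzRingType.

Definition module_class := lmodType R -> Prop.

Definition direct_sum (I : Type) (M : I -> lmodType R) : lmodType R := dsum M.

Definition oplus (M N : lmodType R) : lmodType R := (M * N)%type.

Definition isomorphic (M N : lmodType R) : Prop :=
  exists f : {linear M -> N}, bijective f.

Definition direct_summand (M D : lmodType R) : Prop :=
  exists N : lmodType R, isomorphic (oplus M N) D.

Definition Add_class (K : module_class) : module_class := fun M =>
  exists (J : Type) (X : J -> lmodType R),
    (forall j, K (X j)) /\ direct_summand M (direct_sum X).

Definition add_class (K : module_class) : module_class := fun M =>
  exists (k : nat) (X : 'I_k -> lmodType R),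
    (forall j, K (X j)) /\ direct_summand M (direct_sum X).

(* Exactness of R^m -> R^n -> M -> 0, the first map being v |-> v *m D. *)
Definition finitely_presented : module_class := fun M =>
  exists (m n : nat) (D : 'M[R]_(m, n)) (p : {linear 'rV[R]_n -> M}),
    (forall x : M, exists v : 'rV[R]_n, p v = x) /\
    (forall v : 'rV[R]_n, p v = 0 <-> exists u : 'rV[R]_m, v = u *m D).

Definition pure_projective : module_class := Add_class finitely_presented.

Record direct_system := DirectSystem {
  ds_index : Type;
  ds_le : ds_index -> ds_index -> Prop;
  ds_refl : forall i, ds_le i i;
  ds_antisym : forall i j, ds_le i j -> ds_le j i -> i = j;
  ds_trans : forall i j k, ds_le i j -> ds_le j k -> ds_le i k;
  ds_inhabited : inhabited ds_index;
  ds_directed : forall i j, exists k, ds_le i k /\ ds_le j k;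
  ds_obj : ds_index -> lmodType R;
  ds_map : forall i j, ds_le i j -> {linear ds_obj i -> ds_obj j};
  ds_map_id : forall i (le_ii : ds_le i i) x, ds_map le_ii x = x;
  ds_map_comp : forall i j k (le_ij : ds_le i j) (le_jk : ds_le j k)
    (le_ik : ds_le i k) x, ds_map le_jk (ds_map le_ij x) = ds_map le_ik x
}.

Definition is_cocone (D : direct_system) (L : lmodType R)
    (u : forall i : ds_index D, {linear ds_obj i -> L}) : Prop :=
  forall i j (le_ij : ds_le i j) x, u j (ds_map le_ij x) = u i x.

Definition is_direct_limit (D : direct_system) (L : lmodType R) : Prop :=
  exists u : forall i : ds_index D, {linear ds_obj i -> L},
    is_cocone u /\
    forall (N : lmodType R) (v : forall i : ds_index D, {linear ds_obj i -> N}),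
      is_cocone v ->
      exists w : {linear L -> N},
        (forall i x, w (u i x) = v i x) /\
        (forall w' : {linear L -> N},
           (forall i x, w' (u i x) = v i x) -> w' =1 w).

Definition direct_limits (K : module_class) : module_class := fun L =>
  exists D : direct_system, (forall i : ds_index D, K (ds_obj i)) /\ is_direct_limit D L.

(* The direct limit along an omega-chain given by its one-step maps [g]; a
   cocone over the chain is determined by compatibility with these. *)
Definition is_chain_cocone (X : nat -> lmodType R)
    (g : forall i, {linear X i -> X i.+1}) (L : lmodType R)
    (u : forall i, {linear X i -> L}) : Prop :=
  forall i x, u i.+1 (g i x) = u i x.

Definition is_chain_limit (X : nat -> lmodType R)
    (g : forall i, {linear X i -> X i.+1}) (L : lmodType R) : Prop :=
  exists u : forall i, {linear X i -> L},
    is_chain_cocone g u /\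
    forall (N : lmodType R) (v : forall i, {linear X i -> N}),
      is_chain_cocone g v ->
      exists w : {linear L -> N},
        (forall i x, w (u i x) = v i x) /\
        (forall w' : {linear L -> N},
           (forall i x, w' (u i x) = v i x) -> w' =1 w).

(* Well-scoped syntax: the free variables of [formula n] are indexed by 'I_n,
   a quantifier binds index 0 and shifts the others, and a sentence is a
   [formula 0]. *)
Inductive term (n : nat) : Type :=
  | Var of 'I_n
  | Zero
  | Plus of term n & term n
  | Scale of R & term n.

Inductive formula : nat -> Type :=
  | Equal n of term n & term n : formula n
  | Not n of formula n : formula n
  | And n of formula n & formula n : formula n
  | Or n of formula n & formula n : formula n
  | Exists n of formula n.+1 : formula n
  | Forall n of formula n.+1 : formula n.

Section Semantics.
Variable M : lmodType R.

Definition env_cons n (x : M) (e : 'I_n -> M) : 'I_n.+1 -> M :=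
  fun i => if unlift ord0 i is Some j then e j else x.

Fixpoint eval n (e : 'I_n -> M) (t : term n) : M :=
  match t with
  | Var i => e i
  | Zero => 0
  | Plus t1 t2 => eval e t1 + eval e t2
  | Scale r t1 => r *: eval e t1
  end.

Fixpoint holds n (f : formula n) : ('I_n -> M) -> Prop :=
  match f in formula n return ('I_n -> M) -> Prop with
  | Equal n t1 t2 => fun e => eval e t1 = eval e t2
  | Not n f1 => fun e => ~ holds f1 e
  | And n f1 f2 => fun e => holds f1 e /\ holds f2 e
  | Or n f1 f2 => fun e => holds f1 e \/ holds f2 e
  | Exists n f1 => fun e => exists x, holds f1 (env_cons x e)
  | Forall n f1 => fun e => forall x, holds f1 (env_cons x e)
  end.

End Semantics.

Definition sentence := formula 0.

Definition satisfies (M : lmodType R) (s : sentence) : Prop :=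
  holds s (fun=> 0 : M).

Definition complete_theory (M : lmodType R) : sentence -> Prop := satisfies M.

Definition is_model (T : sentence -> Prop) : module_class := fun M =>
  forall s, T s -> satisfies M s.

Definition class_model (C : module_class) (T : sentence -> Prop) : module_class :=
  fun M => is_model T M /\ C M.

(* [PP A B] is the formula  exists y, A y = B x. *)
Record pp (n : nat) := PP {
  pp_eqns : nat;
  pp_bound : nat;
  pp_lhs : 'M[R]_(pp_eqns, pp_bound);
  pp_rhs : 'M[R]_(pp_eqns, n)
}.

Definition pp_holds n (phi : pp n) (M : lmodType R) (x : 'I_n -> M) : Prop :=
  exists y : 'I_(pp_bound phi) -> M, forall i : 'I_(pp_eqns phi),
    \sum_j pp_lhs phi i j *: y j = \sum_j pp_rhs phi i j *: x j.

Definition pp_le n (phi psi : pp n) : Prop :=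
  forall (M : lmodType R) (x : 'I_n -> M), pp_holds phi x -> pp_holds psi x.

Definition pp_type n (M : lmodType R) (a : 'I_n -> M) : pp n -> Prop :=
  fun phi => pp_holds phi a.

Definition generates n (phi : pp n) (p : pp n -> Prop) : Prop :=
  p phi /\ forall psi, p psi -> pp_le phi psi.

Definition finitely_generated n (p : pp n -> Prop) : Prop :=
  exists phi, generates phi p.

Definition mittag_leffler : module_class := fun M =>
  forall (n : nat) (a : 'I_n -> M), finitely_generated (pp_type a).

(* The members of Gamma_K of arity [n]. *)
Definition Gamma (K : module_class) n (phi : pp n) : Prop :=
  exists (M : lmodType R) (a : 'I_n -> M), K M /\ generates phi (pp_type a).

Definition free_realization n (phi : pp n) (M : lmodType R) (a : 'I_n -> M) :
    Prop :=
  pp_holds phi a /\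
  forall (N : lmodType R) (b : 'I_n -> N), pp_holds phi b ->
    exists f : {linear M -> N}, forall i, f (a i) = b i.

Definition descending n (Phi : nat -> pp n) : Prop :=
  forall i, pp_le (Phi i.+1) (Phi i).

Definition stabilizes n (Phi : nat -> pp n) : Prop :=
  exists m, forall i, (m <= i)%N ->
    forall (M : lmodType R) (x : 'I_n -> M),
      pp_holds (Phi i) x <-> pp_holds (Phi m) x.

(* [B] is one of the Bass modules of the chain [Phi], the finitely presented
   free realizations being chosen inside [K]. For an arbitrary choice of
   finitely presented free realizations, [B] need not be a direct limit of
   modules from [K]. *)
Definition is_bass_module (K : module_class) n (Phi : nat -> pp n)
    (B : lmodType R) : Prop :=
  exists (X : nat -> lmodType R) (a : forall i, 'I_n -> X i)
         (g : forall i, {linear X i -> X i.+1}),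
    [/\ forall i, K (X i) /\ finitely_presented (X i),
        forall i, free_realization (Phi i) (@a i),
        forall i j, g i (a i j) = a i.+1 j
      & is_chain_limit g B].

Section Family.
Variables (I : Type) (A : I -> lmodType R).

Definition family_class : module_class := fun M => exists i, M = A i.

(* The direct sum of countably many copies of every member of the family. *)
Definition F_ : lmodType R := direct_sum (fun p : I * nat => A p.1).

Definition T_ : sentence -> Prop := complete_theory F_.

End Family.

End Modules.

(* Main.v *)
Require Import Defs.
From HB Require Import structures.
From mathcomp Require Import all_boot all_algebra.
From mathcomp Require Import all_classical.

(** Write F for the direct sum of countably many copies of each A i.

    Elementary equivalence of F and F + B. Both modules contain infinitely many
    independent copies of every A i, and every implication between pp formulas
    that holds in all the A i holds in both of them: it passes to direct sums,
    to direct summands and, since a pp formula true in the limit of a chain is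
    already true at some stage, to B. Modules with these two properties are
    called ample ([ample]). Over the ample modules every formula is determined
    by finitely many pp formulas, uniformly ([formula_pp_determined]). This is
    pp elimination of quantifiers, and ampleness makes its only difficult case,
    the existential quantifier, elementary. Consider a system
    phi(x, a) & ~ psi_1(x, a) & .. & ~ psi_k(x, a) and the subgroups defined by
    phi(x, 0) and by (phi & psi_i)(x, 0). If these coincide for psi_i in all
    the A j, then psi_i is either true at all solutions of phi(x, a) or at none
    of them, and a pp condition on a tells which. Otherwise some element z of
    some A j separates them, and adding to a solution of phi(x, a) a copy of z
    in a coordinate where a and the solution vanish makes psi_i false
    ([avoid_open_pairs]); different i use different coordinates, so all of
    these psi_i become false simultaneously. As a pp sentence is always true,
    two ample modules satisfy the same sentences.

    Failure of the Mittag-Leffler property. Let b be the common image in B of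
    the tuples a_i that realize the Phi i freely. If phi generates the pp type
    of b, then phi holds at some stage a_m, whence Phi m <= phi; on the other
    hand b satisfies every Phi i, whence phi <= Phi i. So the chain stabilizes
    at m. The Mittag-Leffler property passes from F + B to its summand B, and
    pure-projective modules have it because finitely presented modules do and
    it is inherited by direct sums and summands.

    Finally F + B is the direct limit of the sums of a finite part of F and a
    stage of the chain, and these sums are in add(A)
    ([direct_limits_oplus]). *)

Set Implicit Arguments.
Unset Strict Implicit.
Unset Printing Implicit Defensive.
Import GRing.Theory.
Local Open Scope ring_scope.

(** * Submodules and quotient modules *)

Section LinearOf.
Variables (R : pzRingType) (U V : lmodType R) (f : U -> V).

Definition linear_of of linear f : U -> V := f.
HB.instance Definition _ (f_lin : linear f) :=
  GRing.isLinear.Build R U V *:%R (linear_of f_lin) f_lin.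

End LinearOf.

Definition is_submodule (R : pzRingType) (M : lmodType R) (P : M -> Prop) :=
  P 0 /\ forall r x y, P x -> P y -> P (r *: x + y).

Section Submodule.
Variables (R : pzRingType) (M : lmodType R) (P : M -> Prop).
Hypothesis subP : is_submodule P.

(** The proof [subP] occurs as a dummy, so that the module structure of the
    subtype, which depends on it, can be inferred from the type alone. *)
Definition submodule_pred : {pred M} := let _ := subP in fun x => `[< P x >].

Fact submodule_pred_closed : submod_closed submodule_pred.
Proof.
split; first by apply/asboolP; exact: subP.1.
by move=> r x y /asboolP Px /asboolP Py; apply/asboolP; exact: subP.2.
Qed.
HB.instance Definition _ :=
  GRing.isSubmodClosed.Build R M submodule_pred submodule_pred_closed.

Record submodule : Type :=
  Submodule { submodule_val : M; _ : submodule_val \in submodule_pred }.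
HB.instance Definition _ := [isSub for submodule_val].
HB.instance Definition _ := [Choice of submodule by <:].
HB.instance Definition _ := [SubChoice_isSubLmodule of submodule by <:].

Lemma submoduleP (x : submodule) : P (submodule_val x).
Proof. by case: x => x /= /asboolP. Qed.

Definition in_submodule x (Px : P x) : submodule :=
  @Submodule x (introT (asboolP (P x)) Px).

Definition submodule_incl : {linear submodule -> M} := [the {linear _ -> _} of val].

Lemma submodule_val_inj : injective submodule_val.
Proof. exact: val_inj. Qed.

Section Corestriction.
Variables (N : lmodType R) (f : {linear N -> M}).
Hypothesis f_in : forall x, P (f x).

Definition corestrict (x : N) : submodule := in_submodule (f_in x).
Fact corestrict_linear : linear corestrict.
Proof. by move=> r x y; apply: submodule_val_inj; exact: linearP. Qed.
HB.instance Definition _ :=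
  GRing.isLinear.Build R N submodule *:%R corestrict corestrict_linear.

End Corestriction.

End Submodule.

Section Quotient.
Variables (R : pzRingType) (M : lmodType R) (P : M -> Prop).
Hypothesis subP : is_submodule P.

Let P0 : P 0 := subP.1.
Let PZ r x : P x -> P (r *: x).
Proof. by move=> Px; rewrite -[_ *: _]addr0; apply: subP.2. Qed.
Let PD x y : P x -> P y -> P (x + y).
Proof. by move=> Px Py; rewrite -[x]scale1r; apply: subP.2. Qed.
Let PN x : P x -> P (- x).
Proof. by move=> Px; rewrite -scaleN1r; exact: PZ. Qed.

(** The representative of x + P is chosen by a predicate that depends on the
    coset only; the quotient is carried by the set of representatives. *)
Definition coset_repr (x : M) : M :=
  let _ := subP in choose (fun y => `[< P (x - y) >]) x.

Lemma coset_reprP x : P (x - coset_repr x).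
Proof.
apply/asboolP; rewrite /coset_repr.
by apply: (chooseP (P := fun y => `[< P (x - y) >])); apply/asboolP; rewrite subrr.
Qed.

Lemma coset_repr_eq x y : P (x - y) -> coset_repr x = coset_repr y.
Proof.
move=> Pxy; rewrite /coset_repr.
have -> : (fun z => `[< P (x - z) >]) = (fun z => `[< P (y - z) >]).
  apply/funext => z; apply/asbool_equiv_eq; split=> h.
    by rewrite -(subrKA x) addrC; apply: PD => //; rewrite -opprB; apply: PN.
  by rewrite -(subrKA y); apply: PD.
apply: choose_id; apply/asboolP; last by rewrite subrr.
by rewrite -opprB; apply: PN.
Qed.

Record quotient := Quotient { quotient_val : M;
  _ : coset_repr quotient_val == quotient_val }.
HB.instance Definition _ := [isSub for quotient_val].
HB.instance Definition _ := [Choice of quotient by <:].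

Fact coset_repr_idem x : coset_repr (coset_repr x) == coset_repr x.
Proof. by apply/eqP/esym/coset_repr_eq/coset_reprP. Qed.

Definition quotient_mk x : quotient := Quotient (coset_repr_idem x).

Lemma quotient_mk_eq x y : P (x - y) -> quotient_mk x = quotient_mk y.
Proof. by move=> Pxy; apply: val_inj; exact: coset_repr_eq. Qed.

Lemma quotient_mkK x : quotient_mk (quotient_val x) = x.
Proof. by apply: val_inj; case: x => x /= /eqP. Qed.

Lemma quotient_valK x : P (x - quotient_val (quotient_mk x)).
Proof. exact: coset_reprP. Qed.

Let qopp x := quotient_mk (- quotient_val x).
Let qadd x y := quotient_mk (quotient_val x + quotient_val y).
Let qscale r x := quotient_mk (r *: quotient_val x).

Let qaddE x y : qadd (quotient_mk x) (quotient_mk y) = quotient_mk (x + y).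
Proof.
apply: quotient_mk_eq; rewrite opprD addrACA.
by apply: PD; rewrite -opprB; apply: PN; exact: quotient_valK.
Qed.
Let qoppE x : qopp (quotient_mk x) = quotient_mk (- x).
Proof.
by apply: quotient_mk_eq; rewrite opprK addrC; exact: quotient_valK.
Qed.
Let qscaleE r x : qscale r (quotient_mk x) = quotient_mk (r *: x).
Proof.
apply: quotient_mk_eq; rewrite -scalerBr; apply: PZ.
by rewrite -opprB; apply: PN; exact: quotient_valK.
Qed.
Let ind (Q : quotient -> Prop) : (forall x, Q (quotient_mk x)) -> forall x, Q x.
Proof. by move=> h x; rewrite -(quotient_mkK x). Qed.

Fact quotient_addA : associative qadd.
Proof. by elim/ind=> x; elim/ind=> y; elim/ind=> z; rewrite !qaddE addrA. Qed.
Fact quotient_addC : commutative qadd.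
Proof. by elim/ind=> x; elim/ind=> y; rewrite !qaddE addrC. Qed.
Fact quotient_add0 : left_id (quotient_mk 0) qadd.
Proof. by elim/ind=> x; rewrite !qaddE add0r. Qed.
Fact quotient_addN : left_inverse (quotient_mk 0) qopp qadd.
Proof. by elim/ind=> x; rewrite qoppE !qaddE addNr. Qed.
HB.instance Definition _ := GRing.isZmodule.Build quotient
  quotient_addA quotient_addC quotient_add0 quotient_addN.

Fact quotient_scaleA r s x : qscale r (qscale s x) = qscale (r * s) x.
Proof. by elim/ind: x => x; rewrite !qscaleE scalerA. Qed.
Fact quotient_scale1 : left_id 1 qscale.
Proof. by elim/ind => x; rewrite !qscaleE scale1r. Qed.
Fact quotient_scaleDr : right_distributive qscale +%R.
Proof.
move=> r; elim/ind=> x; elim/ind=> y.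
by rewrite ![_ + _ in X in X = _]qaddE ![qscale r _]qscaleE [RHS]qaddE scalerDr.
Qed.
Fact quotient_scaleDl x : {morph qscale^~ x : r s / r + s}.
Proof. by move=> r s; elim/ind: x => x; rewrite !qscaleE [RHS]qaddE scalerDl. Qed.
HB.instance Definition _ := GRing.Zmodule_isLmodule.Build R quotient
  quotient_scaleA quotient_scale1 quotient_scaleDr quotient_scaleDl.

Fact quotient_mk_linear : linear quotient_mk.
Proof. by move=> r x y; rewrite -[LHS]qaddE -[X in qadd X]qscaleE. Qed.
HB.instance Definition _ :=
  GRing.isLinear.Build R M quotient *:%R quotient_mk quotient_mk_linear.

Lemma quotient_mk_eq0 x : quotient_mk x = 0 -> P x.
Proof.
move=> /(congr1 quotient_val) /= x0; rewrite -[x]subr0 -(subrKA (coset_repr x)).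
apply: PD; first exact: coset_reprP.
by rewrite x0 -opprB; apply: PN; exact: coset_reprP.
Qed.

End Quotient.

(** * The calculus of pp formulas *)

Section PP.
Variable R : pzRingType.
Implicit Types M N : lmodType R.

Lemma pp_holds_ext n (phi : pp R n) M (x y : 'I_n -> M) :
  x =1 y -> pp_holds phi x -> pp_holds phi y.
Proof. by move=> /funext->. Qed.

Lemma pp_holds_linear n (phi : pp R n) M N (f : {linear M -> N})
    (x : 'I_n -> M) :
  pp_holds phi x -> pp_holds phi (f \o x).
Proof.
move=> [y yE]; exists (f \o y) => i.
have:= congr1 f (yE i); rewrite !linear_sum => h.
by under eq_bigr do rewrite /= -linearZ; rewrite h;
  under eq_bigr do rewrite linearZ.
Qed.

Lemma pp_holds0 n (phi : pp R n) M : pp_holds phi (fun=> 0 : M).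
Proof. by exists (fun=> 0) => i; rewrite !big1 // => j _; rewrite scaler0. Qed.

Lemma pp_holdsD n (phi : pp R n) M (x y : 'I_n -> M) :
  pp_holds phi x -> pp_holds phi y -> pp_holds phi (fun i => x i + y i).
Proof.
move=> [x' x'E] [y' y'E]; exists (fun i => x' i + y' i) => i.
under eq_bigr do rewrite scalerDr.
under [RHS]eq_bigr do rewrite scalerDr.
by rewrite !big_split /= x'E y'E.
Qed.

Lemma pp_holdsB n (phi : pp R n) M (x y : 'I_n -> M) :
  pp_holds phi x -> pp_holds phi y -> pp_holds phi (fun i => x i - y i).
Proof.
move=> [x' x'E] [y' y'E]; exists (fun i => x' i - y' i) => i.
under eq_bigr do rewrite scalerBr.
under [RHS]eq_bigr do rewrite scalerBr.
by rewrite !sumrB x'E y'E.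
Qed.

Lemma pp_holds_sum n (phi : pp R n) M (J : Type) (s : seq J)
    (x : J -> 'I_n -> M) :
  (forall j, pp_holds phi (x j)) -> pp_holds phi (fun i => \sum_(j <- s) x j i).
Proof.
move=> phix; elim: s => [|j s ihs].
  by apply: pp_holds_ext (pp_holds0 _ _) => i; rewrite big_nil.
by apply: pp_holds_ext (pp_holdsD (phix j) ihs) => i; rewrite big_cons.
Qed.

Definition cat_fun (T : Type) m n (x : 'I_m -> T) (y : 'I_n -> T)
    (i : 'I_(m + n)) : T :=
  match fintype.split i with inl j => x j | inr j => y j end.

Lemma cat_funl T m n (x : 'I_m -> T) (y : 'I_n -> T) i :
  cat_fun x y (lshift n i) = x i.
Proof. by rewrite /cat_fun -[lshift n i]/(unsplit (inl _ i)) unsplitK. Qed.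

Lemma cat_funr T m n (x : 'I_m -> T) (y : 'I_n -> T) i :
  cat_fun x y (rshift m i) = y i.
Proof. by rewrite /cat_fun -[rshift m i]/(unsplit (inr _ i)) unsplitK. Qed.

Definition pp_true n : pp R n := PP (0 : 'M_(0, 0)) (0 : 'M_(0, n)).

Lemma pp_holds_true n M (x : 'I_n -> M) : pp_holds (pp_true n) x.
Proof. by exists (fun=> 0) => -[]. Qed.

Definition pp_and n (phi psi : pp R n) : pp R n :=
  PP (block_mx (pp_lhs phi) 0 0 (pp_lhs psi)) (col_mx (pp_rhs phi) (pp_rhs psi)).

Lemma pp_holds_and n (phi psi : pp R n) M (x : 'I_n -> M) :
  pp_holds (pp_and phi psi) x <-> pp_holds phi x /\ pp_holds psi x.
Proof.
split=> [[y yE]|[[y yE] [z zE]]].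
  split; [exists (y \o lshift _) => i; have := yE (lshift _ i)
         |exists (y \o @rshift _ _) => i; have := yE (rshift _ i)];
  rewrite big_split_ord /=.
  - under eq_bigr do rewrite block_mxEul.
    under [X in _ + X]eq_bigr do rewrite block_mxEur mxE scale0r.
    under [RHS]eq_bigr do rewrite col_mxEu.
    by rewrite [X in _ + X]big1 // addr0.
  - under eq_bigr do rewrite block_mxEdl mxE scale0r.
    under [X in _ + X]eq_bigr do rewrite block_mxEdr.
    under [RHS]eq_bigr do rewrite col_mxEd.
    by rewrite [X in X + _]big1 // add0r.
exists (cat_fun y z) => i /=; rewrite big_split_ord /=.
under eq_bigr do rewrite cat_funl.
under [X in _ + X]eq_bigr do rewrite cat_funr.
have [k ->|k ->] := split_ordP i.
- under eq_bigr do rewrite block_mxEul.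
  under [X in _ + X]eq_bigr do rewrite block_mxEur mxE scale0r.
  under [RHS]eq_bigr do rewrite col_mxEu.
  by rewrite [X in _ + X]big1 // addr0.
- under eq_bigr do rewrite block_mxEdl mxE scale0r.
  under [X in _ + X]eq_bigr do rewrite block_mxEdr.
  under [RHS]eq_bigr do rewrite col_mxEd.
  by rewrite [X in X + _]big1 // add0r.
Qed.

Definition pp_conj n (T : eqType) (phi : T -> pp R n) (s : seq T) : pp R n :=
  foldr (fun t => pp_and (phi t)) (pp_true n) s.

Lemma pp_holds_conj n (T : eqType) (phi : T -> pp R n) (s : seq T) M
    (x : 'I_n -> M) :
  pp_holds (pp_conj phi s) x <-> forall t, t \in s -> pp_holds (phi t) x.
Proof.
elim: s => [|t s ihs]; first by split=> // _; exact: pp_holds_true.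
rewrite /= -/(pp_conj phi s) pp_holds_and ihs; split=> [[ht hs] u|h].
  by rewrite in_cons => /predU1P[->|/hs].
by split=> [|u us]; apply: h; rewrite ?mem_head // in_cons us orbT.
Qed.

Lemma env_cons0 n M (z : M) (x : 'I_n -> M) : env_cons z x ord0 = z.
Proof. by rewrite /env_cons unlift_none. Qed.

Lemma env_consS n M (z : M) (x : 'I_n -> M) i :
  env_cons z x (lift ord0 i) = x i.
Proof. by rewrite /env_cons liftK. Qed.

Lemma env_cons_ext n M (z : M) (x : 'I_n -> M) (y : 'I_n.+1 -> M) :
  y ord0 = z -> (forall i, y (lift ord0 i) = x i) -> env_cons z x =1 y.
Proof.
move=> y0 yS i; have [j ->|->] := unliftP ord0 i; last by rewrite env_cons0.
by rewrite env_consS yS.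
Qed.

(** Quantifying the variable of index 0 moves its column, with the opposite
    sign, to the left-hand side. *)
Definition pp_exists n (phi : pp R n.+1) : pp R n :=
  PP (row_mx (pp_lhs phi) (- col ord0 (pp_rhs phi))) (col' ord0 (pp_rhs phi)).

Lemma pp_holds_exists n (phi : pp R n.+1) M (x : 'I_n -> M) :
  pp_holds (pp_exists phi) x <-> exists z, pp_holds phi (env_cons z x).
Proof.
split=> [[y yE]|[z [y yE]]].
  exists (y (rshift _ ord0)), (y \o lshift _) => i; have := yE i.
  rewrite big_split_ord /= big_ord1 => /eqP.
  under eq_bigr do rewrite row_mxEl.
  rewrite row_mxEr !mxE scaleNr subr_eq addrC => /eqP ->.
  rewrite big_ord_recl env_cons0; congr (_ + _).
  by apply: eq_bigr => j _; rewrite env_consS mxE.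
exists (cat_fun y (fun=> z)) => i.
rewrite big_split_ord /= big_ord1 row_mxEr cat_funr !mxE scaleNr.
under eq_bigr do rewrite row_mxEl cat_funl.
rewrite yE big_ord_recl env_cons0 addrAC subrr add0r.
by apply: eq_bigr => j _; rewrite env_consS mxE.
Qed.

(** The formula phi(z, 0) in the single variable z: it defines the subgroup of
    which the nonempty sets phi(_, a) are cosets. *)
Definition pp_fiber n (phi : pp R n.+1) : pp R 1 :=
  PP (pp_lhs phi) (col ord0 (pp_rhs phi)).

Lemma pp_holds_fiber n (phi : pp R n.+1) M (z : M) :
  pp_holds (pp_fiber phi) (fun=> z) <-> pp_holds phi (env_cons z (fun=> 0)).
Proof.
split=> -[y yE]; exists y => i; have:= yE i; rewrite /= => ->;
  rewrite ?big_ord_recl ?big_ord0 ?addr0 env_cons0 ?mxE big1 ?addr0 //;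
  by move=> j _; rewrite env_consS scaler0.
Qed.

(** The equations x = 0, the neutral element of [pp_add]. *)
Definition pp_zero n : pp R n := PP (0 : 'M_(n, 0)) 1%:M.

Lemma pp_holds_zero n M (x : 'I_n -> M) :
  pp_holds (pp_zero n) x <-> forall i, x i = 0.
Proof.
have sumE i : \sum_j (1%:M : 'M[R]_n) i j *: x j = x i.
  rewrite (bigD1 i) //= mxE eqxx scale1r big1 ?addr0 // => j /negPf ji.
  by rewrite mxE eq_sym ji scale0r.
split=> [[y yE] i|x0]; first by rewrite -sumE -yE big_ord0.
by exists (fun=> 0) => i; rewrite sumE x0 big_ord0.
Qed.

(** The formula for phi + psi: the equations A y = B z of phi and
    A' y' = B' (x - z) of psi, with the splitting x = z + (x - z) quantified. *)
Definition pp_add n (phi psi : pp R n) : pp R n :=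
  PP (row_mx (block_mx (pp_lhs phi) 0 0 (pp_lhs psi))
             (col_mx (- pp_rhs phi) (pp_rhs psi)))
     (col_mx 0 (pp_rhs psi)).

Lemma pp_holds_add n (phi psi : pp R n) M (x : 'I_n -> M) :
  pp_holds (pp_add phi psi) x <->
  exists z, pp_holds phi z /\ pp_holds psi (fun i => x i - z i).
Proof.
split=> [[y yE]|[z [[y yE] [y' y'E]]]].
  exists (y \o @rshift _ _); split.
    exists (y \o lshift _ \o lshift _) => i; have := yE (lshift _ i).
    rewrite !big_split_ord /= => /eqP.
    under eq_bigr do rewrite row_mxEl block_mxEul.
    under [X in _ + X + _]eq_bigr do rewrite row_mxEl block_mxEur mxE scale0r.
    under [X in _ + _ + X]eq_bigr do rewrite row_mxEr col_mxEu mxE scaleNr.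
    under [X in _ == X]eq_bigr do rewrite col_mxEu mxE scale0r.
    rewrite [X in _ + X + _]big1 // addr0 [X in _ == X]big1 //.
    by rewrite sumrN subr_eq0 => /eqP.
  exists (y \o lshift _ \o @rshift _ _) => i; have := yE (rshift _ i).
  rewrite !big_split_ord /= => /eqP.
  under eq_bigr do rewrite row_mxEl block_mxEdl mxE scale0r.
  under [X in _ + X + _]eq_bigr do rewrite row_mxEl block_mxEdr.
  under [X in _ + _ + X]eq_bigr do rewrite row_mxEr col_mxEd.
  under [X in _ == X]eq_bigr do rewrite col_mxEd.
  rewrite [X in X + _ + _]big1 // add0r eq_sym -subr_eq => /eqP <-.
  by under [RHS]eq_bigr do rewrite scalerBr; rewrite sumrB.
exists (cat_fun (cat_fun y y') z) => i; rewrite !big_split_ord /=.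
under eq_bigr do rewrite cat_funl cat_funl.
under [X in _ + X + _]eq_bigr do rewrite cat_funl cat_funr.
under [X in _ + _ + X]eq_bigr do rewrite cat_funr.
have [k ->|k ->] := split_ordP i.
- under eq_bigr do rewrite row_mxEl block_mxEul.
  under [X in _ + X + _]eq_bigr do rewrite row_mxEl block_mxEur mxE scale0r.
  under [X in _ + _ + X]eq_bigr do rewrite row_mxEr col_mxEu mxE scaleNr.
  under [RHS]eq_bigr do rewrite col_mxEu mxE scale0r.
  rewrite [X in _ + X + _]big1 // addr0 [RHS]big1 //.
  by rewrite sumrN yE subrr.
- under eq_bigr do rewrite row_mxEl block_mxEdl mxE scale0r.
  under [X in _ + X + _]eq_bigr do rewrite row_mxEl block_mxEdr.
  under [X in _ + _ + X]eq_bigr do rewrite row_mxEr col_mxEd.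
  under [RHS]eq_bigr do rewrite col_mxEd.
  rewrite [X in X + _ + _]big1 // add0r y'E -big_split /=.
  by apply: eq_bigr => j _; rewrite -scalerDr subrK.
Qed.

Definition pp_sum n (J : Type) (phi : J -> pp R n) (s : seq J) : pp R n :=
  foldr (fun j => pp_add (phi j)) (pp_zero n) s.

Lemma pp_holds_pp_sum n (J : Type) (phi : J -> pp R n) (s : seq J) M
    (x : J -> 'I_n -> M) :
  (forall j, pp_holds (phi j) (x j)) ->
  pp_holds (pp_sum phi s) (fun i => \sum_(j <- s) x j i).
Proof.
move=> phix; elim: s => [|j s ihs] /=.
  by apply/pp_holds_zero => i; rewrite big_nil.
apply/pp_holds_add; exists (x j); split=> //.
by apply: pp_holds_ext ihs => i; rewrite big_cons addrAC subrr add0r.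
Qed.

Lemma pp_sum_le n (J : Type) (phi : J -> pp R n) (s : seq J) (psi : pp R n) :
  (forall j, pp_le (phi j) psi) -> pp_le (pp_sum phi s) psi.
Proof.
move=> le_psi; elim: s => [|j s ihs] M x /=.
  by move/pp_holds_zero => x0; apply: pp_holds_ext (pp_holds0 _ _) => i.
move/pp_holds_add => [z [zj /ihs zs]].
by apply: pp_holds_ext (pp_holdsD (le_psi _ _ _ zj) zs) => i; rewrite addrC subrK.
Qed.

End PP.

(** * Direct sums and the class add *)

Section DirectSums.
Variable R : pzRingType.

Section Coordinates.
Variables (I : Type) (M : I -> lmodType R).

Lemma dsum_ext (f g : direct_sum M) :
  (forall p, dsum_val f p = dsum_val g p) -> f = g.
Proof. by move=> fg; apply: val_inj; apply: functional_extensionality_dep. Qed.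

Lemma dsum_support (f : direct_sum M) :
  exists s : seq {classic I}, uniq s /\ forall p, dsum_val f p <> 0 -> p \in s.
Proof.
case: f => f /= /asboolP /(@finite_seqP {classic I})[s fs].
exists (@undup {classic I} s); split; first exact: undup_uniq.
move=> p fp; rewrite (@mem_undup {classic I}).
by have: [set` s]%classic p by rewrite -fs.
Qed.

Lemma dsum_support_tuple n (x : 'I_n -> direct_sum M) :
  exists s : seq {classic I}, uniq s /\
    forall j p, dsum_val (x j) p <> 0 -> p \in s.
Proof.
have /choice[s sP] j := dsum_support (x j).
exists (@undup {classic I} (flatten [seq s j | j <- enum 'I_n])).
split=> [|j p xp]; first exact: undup_uniq.
rewrite (@mem_undup {classic I}).
apply/flatten_mapP; exists j; first by rewrite mem_enum.
exact: (sP j).2.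
Qed.

Definition dsum_coord (p : I) (f : direct_sum M) : M p := dsum_val f p.
Fact dsum_coord_linear p : linear (dsum_coord p).
Proof. by []. Qed.
HB.instance Definition _ p :=
  GRing.isLinear.Build R (direct_sum M) (M p) *:%R (dsum_coord p)
    (@dsum_coord_linear p).

(** The index type has no decidable equality, and the coordinate p has type
    [M p] only, hence the transport along p = q. *)
Definition dprod_single (p : I) (z : M p) : dprod M := fun q =>
  match pselect (p = q) with
  | left e => eq_rect p (fun i => M i) z q e
  | right _ => 0
  end.

Lemma dprod_singleE p (z : M p) : dprod_single z p = z.
Proof.
by rewrite /dprod_single; case: pselect => // e; rewrite (Prop_irrelevance e erefl).
Qed.

Lemma dprod_single_neq p q (z : M p) : p <> q -> dprod_single z q = 0.
Proof. by rewrite /dprod_single; case: pselect. Qed.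

Fact dprod_single_finsupp p (z : M p) : dprod_single z \in finsupp (M:=M).
Proof.
apply/asboolP; apply: sub_finite_set (finite_set1 p) => q /= zq.
by apply: contrapT => qp; apply: zq; apply: dprod_single_neq => /esym.
Qed.

Definition dsum_inj p (z : M p) : direct_sum M := DSum (dprod_single_finsupp z).

Lemma dsum_injE p (z : M p) : dsum_val (dsum_inj z) p = z.
Proof. exact: dprod_singleE. Qed.

Lemma dsum_inj_neq p q (z : M p) : p <> q -> dsum_val (dsum_inj z) q = 0.
Proof. exact: dprod_single_neq. Qed.

Fact dsum_inj_linear p : linear (@dsum_inj p).
Proof.
move=> r x y; apply: dsum_ext => q.
rewrite -[RHS]/(r *: dsum_val (dsum_inj x) q + dsum_val (dsum_inj y) q).
have [<-|pq] := pselect (p = q); first by rewrite !dsum_injE.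
by rewrite !dsum_inj_neq // scaler0 addr0.
Qed.
HB.instance Definition _ p :=
  GRing.isLinear.Build R (M p) (direct_sum M) *:%R (@dsum_inj p)
    (@dsum_inj_linear p).

End Coordinates.

Lemma dsum_decomp (I : eqType) (M : I -> lmodType R) (f : direct_sum M)
    (s : seq I) :
  uniq s -> (forall p, dsum_val f p <> 0 -> p \in s) ->
  f = \sum_(p <- s) dsum_inj (dsum_val f p).
Proof.
move=> us fs; apply: dsum_ext => q.
rewrite -[RHS]/(dsum_coord q _) linear_sum /=.
have [qs|qs] := boolP (q \in s).
  rewrite (bigD1_seq q) //= big1 => [|p /eqP pq]; last exact: dsum_inj_neq.
  by rewrite addr0 dprod_singleE.
rewrite big_seq big1 => [|p ps].
  by apply: contrapT => fq; move: qs; rewrite fs.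
by apply: dsum_inj_neq => pq; move: qs; rewrite -pq ps.
Qed.

Section Oplus.
Variables M N : lmodType R.

Definition oplus_inl (x : M) : oplus M N := (x, 0).
Fact oplus_inl_linear : linear oplus_inl.
Proof. by move=> r x y; apply/pair_equal_spec; rewrite /= scaler0 addr0. Qed.
HB.instance Definition _ :=
  GRing.isLinear.Build R M (oplus M N) *:%R oplus_inl oplus_inl_linear.

Definition oplus_inr (y : N) : oplus M N := (0, y).
Fact oplus_inr_linear : linear oplus_inr.
Proof. by move=> r x y; apply/pair_equal_spec; rewrite /= scaler0 addr0. Qed.
HB.instance Definition _ :=
  GRing.isLinear.Build R N (oplus M N) *:%R oplus_inr oplus_inr_linear.

Definition oplus_fst (x : oplus M N) : M := x.1.
Fact oplus_fst_linear : linear oplus_fst. Proof. by []. Qed.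
HB.instance Definition _ :=
  GRing.isLinear.Build R (oplus M N) M *:%R oplus_fst oplus_fst_linear.

Definition oplus_snd (x : oplus M N) : N := x.2.
Fact oplus_snd_linear : linear oplus_snd. Proof. by []. Qed.
HB.instance Definition _ :=
  GRing.isLinear.Build R (oplus M N) N *:%R oplus_snd oplus_snd_linear.

Lemma oplus_decomp (x : oplus M N) :
  x = oplus_inl (oplus_fst x) + oplus_inr (oplus_snd x).
Proof.
by case: x => x y; apply/pair_equal_spec; rewrite /= addr0 add0r.
Qed.

End Oplus.

Section OplusMap.
Variables (M M' N N' : lmodType R) (f : {linear M -> M'}) (g : {linear N -> N'}).

Definition oplus_map (x : oplus M N) : oplus M' N' := (f x.1, g x.2).
Fact oplus_map_linear : linear oplus_map.
Proof. by move=> r x y; apply/pair_equal_spec; rewrite /= !linearP. Qed.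
HB.instance Definition _ := GRing.isLinear.Build R (oplus M N) (oplus M' N') *:%R
  oplus_map oplus_map_linear.

End OplusMap.

(** A split injection exhibits a direct summand, the complement being the
    kernel of the retraction. *)
Lemma direct_summand_retract (M D : lmodType R) (i : {linear M -> D})
    (p : {linear D -> M}) :
  cancel i p -> direct_summand M D.
Proof.
move=> iK.
have kerP : is_submodule (fun x => p x = 0).
  split; first exact: linear0.
  by move=> r x y px py; rewrite linearP px py scaler0 addr0.
pose N : lmodType R := submodule kerP.
have f_lin : linear (fun x : oplus M N => i x.1 + submodule_val x.2).
  move=> r x y; rewrite linearP -[submodule_val (_ + _).2]/(submodule_incl kerP _).
  by rewrite linearP /= scalerDr addrACA.
exists N, (linear_of f_lin).
have res d : p (d - i (p d)) = 0 by rewrite linearB iK subrr.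
exists (fun d => (p d, in_submodule kerP (res d))) => [[m [n ns]]|d] /=.
  have pn : p n = 0 by apply: (asboolW ns).
  rewrite /linear_of /=; congr (_, _).
    by rewrite linearD iK pn addr0.
  by apply: submodule_val_inj; rewrite /= linearD iK pn addr0 addrAC subrr add0r.
by rewrite /linear_of /= addrC subrK.
Qed.

Lemma retract_direct_summand (M D : lmodType R) :
  direct_summand M D ->
  exists (i : {linear M -> D}) (p : {linear D -> M}), cancel i p.
Proof.
move=> [N [f [g gK fK]]].
have g_lin : linear (g : D -> oplus M N).
  by move=> r x y; rewrite -{1}[x]fK -{1}[y]fK -linearP gK.
exists [the {linear _ -> _} of f \o @oplus_inl M N].
exists [the {linear _ -> _} of @oplus_fst M N \o linear_of g_lin] => x.
by rewrite /= /linear_of gK.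
Qed.

(** Membership in add(K) amounts to a decomposition of the identity of M into
    finitely many maps that factor through members of K. Over an arbitrary
    finite index type, closure under sums is then a disjoint union of indices. *)
Lemma add_classP (K : module_class R) (M : lmodType R) :
  add_class K M <->
  exists (T : finType) (X : T -> lmodType R) (inj : forall t, {linear X t -> M})
    (proj : forall t, {linear M -> X t}),
    (forall t, K (X t)) /\ forall x, x = \sum_t inj t (proj t x).
Proof.
split=> [[k [X [KX /retract_direct_summand[i [p iK]]]]]|
         [T [X [inj [proj [KX injK]]]]]].
  exists 'I_k, X, (fun t => [the {linear _ -> _} of p \o @dsum_inj 'I_k X t]),
    (fun t => [the {linear _ -> _} of @dsum_coord 'I_k X t \o i]).
  split=> // x; rewrite -[LHS]iK [in LHS](@dsum_decomp _ _ (i x) (enum 'I_k)).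
  - by rewrite linear_sum big_enum.
  - exact: enum_uniq.
  - by move=> j _; rewrite mem_enum.
pose e (j : 'I_#|T|) : T := enum_val j.
exists #|T|, (X \o e); split=> [j|]; first exact: KX.
pose pr x : dprod (X \o e) := fun j => proj (e j) x.
have pr_fin x : pr x \in finsupp (M := X \o e).
  by apply/asboolP; exact: finite_finset.
have i_lin : linear (fun x => DSum (pr_fin x) : direct_sum (X \o e)).
  by move=> r x y; apply: dsum_ext => j; exact: linearP.
have p_lin : linear (fun f : direct_sum (X \o e) =>
    \sum_j inj (e j) (dsum_val f j)).
  move=> r x y; rewrite scaler_sumr -big_split /=; apply: eq_bigr => j _.
  by rewrite -linearP.
apply: (@direct_summand_retract _ _ (linear_of i_lin) (linear_of p_lin)) => x.
rewrite /linear_of /= [RHS]injK.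
by rewrite (reindex e) //=; apply: onW_bij; exact: enum_val_bij.
Qed.

Lemma add_class_oplus (K : module_class R) (M N : lmodType R) :
  add_class K M -> add_class K N -> add_class K (oplus M N).
Proof.
move=> /add_classP[T [X [inj [proj [KX injK]]]]].
move=> /add_classP[T' [X' [inj' [proj' [KX' injK']]]]].
pose Y (t : T + T') := match t with inl t => X t | inr t => X' t end.
pose injY t : {linear Y t -> oplus M N} := match t with
  | inl t => [the {linear _ -> _} of @oplus_inl M N \o inj t]
  | inr t => [the {linear _ -> _} of @oplus_inr M N \o inj' t] end.
pose projY t : {linear oplus M N -> Y t} := match t with
  | inl t => [the {linear _ -> _} of proj t \o @oplus_fst M N]
  | inr t => [the {linear _ -> _} of proj' t \o @oplus_snd M N] end.
apply/add_classP; exists (T + T')%type, Y, injY, projY; split.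
  by case.
by move=> x; rewrite {1}[x]oplus_decomp big_sumType /= -!linear_sum -injK -injK'.
Qed.

End DirectSums.

(** * Elimination of quantifiers in ample modules *)

Section Elimination.
Variables (R : pzRingType) (I : Type) (A : I -> lmodType R).

Definition pp_implies (M : lmodType R) n (phi psi : pp R n) : Prop :=
  forall x : 'I_n -> M, pp_holds phi x -> pp_holds psi x.

Definition inherits_pp_implications (N : lmodType R) : Prop :=
  forall n (phi psi : pp R n),
    (forall i, pp_implies (A i) phi psi) -> pp_implies N phi psi.

(** Pairwise independent copies of the A i, indexed by m; only finitely many
    m see a given element of N. Copies of different A i with the same index m
    need not be independent. *)
Definition has_free_copies (N : lmodType R) : Prop :=
  exists (inj : forall i, nat -> {linear A i -> N})
         (proj : forall i, nat -> {linear N -> A i}),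
    [/\ forall i m z, proj i m (inj i m z) = z,
        forall i i' m m' z, m != m' -> proj i' m' (inj i m z) = 0
      & forall x, exists m0, forall i m, (m0 <= m)%N -> proj i m x = 0].

Definition ample (N : lmodType R) : Prop :=
  inherits_pp_implications N /\ has_free_copies N.

(** This is the obstruction to separating psi from phi: inside the solutions of
    phi over given parameters, psi is then true everywhere or nowhere. *)
Definition closed_pair n (phi psi : pp R n.+1) : Prop :=
  forall i, pp_implies (A i) (pp_fiber phi) (pp_fiber psi).

Lemma closed_pair_ample n (phi psi : pp R n.+1) (N : lmodType R) (h : N) :
  ample N -> closed_pair phi psi ->
  pp_holds phi (env_cons h (fun=> 0)) -> pp_holds psi (env_cons h (fun=> 0)).
Proof.
move=> [inN _] phi_psi /pp_holds_fiber phih; apply/pp_holds_fiber.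
exact: inN phi_psi _ phih.
Qed.

Lemma open_pair_witness n (phi psi : pp R n.+1) :
  ~ closed_pair phi psi ->
  exists i (z : A i), pp_holds phi (env_cons z (fun=> 0)) /\
    ~ pp_holds psi (env_cons z (fun=> 0)).
Proof.
move=> /existsNP[i /existsNP[x /not_implyP[phix psix]]].
have xE : x = (fun=> x ord0) by apply/funext => j; rewrite ord1.
exists i, (x ord0); split; first by apply/pp_holds_fiber; rewrite -xE.
by move=> /pp_holds_fiber; rewrite -xE.
Qed.

Lemma linear_env_cons n (M N : lmodType R) (f : {linear M -> N}) (z : M)
    (x : 'I_n -> M) :
  f \o env_cons z x = env_cons (f z) (f \o x).
Proof.
apply/esym/funext/env_cons_ext => [|i] /=; first by rewrite env_cons0.
by rewrite env_consS.
Qed.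

Lemma pp_holds_linear_fiber n (phi : pp R n.+1) (M N : lmodType R)
    (f : {linear M -> N}) (z : M) :
  pp_holds phi (env_cons z (fun=> 0)) ->
  pp_holds phi (env_cons (f z) (fun=> 0)).
Proof.
move=> /(pp_holds_linear f); rewrite linear_env_cons.
by congr (pp_holds phi (env_cons _ _)); apply/funext => i /=; rewrite linear0.
Qed.

Lemma env_consD n (M : lmodType R) (z z' : M) (x x' : 'I_n -> M) :
  env_cons (z + z') (fun i => x i + x' i) =
  (fun i => env_cons z x i + env_cons z' x' i).
Proof. by apply/funext/env_cons_ext => [|i]; rewrite ?env_cons0 ?env_consS. Qed.

Lemma pp_holds_env_consD n (phi : pp R n.+1) (M : lmodType R) (z h : M)
    (x : 'I_n -> M) :
  pp_holds phi (env_cons z x) -> pp_holds phi (env_cons h (fun=> 0)) ->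
  pp_holds phi (env_cons (z + h) x).
Proof.
move=> phiz phih; have := pp_holdsD phiz phih; rewrite -env_consD.
by congr (pp_holds phi (env_cons _ _)); apply/funext => i; rewrite addr0.
Qed.

Lemma pp_holds_env_consB n (phi : pp R n.+1) (M : lmodType R) (z z' : M)
    (x : 'I_n -> M) :
  pp_holds phi (env_cons z x) -> pp_holds phi (env_cons z' x) ->
  pp_holds phi (env_cons (z - z') (fun=> 0)).
Proof.
move=> phiz phiz'; apply: pp_holds_ext (pp_holdsB phiz phiz') => i.
move: i; apply: fsym; apply: env_cons_ext => [|i]; first by rewrite !env_cons0.
by rewrite !env_consS subrr.
Qed.

Lemma uniform_bound (m : nat) (P : 'I_m -> nat -> Prop) :
  (forall i j k, (j <= k)%N -> P i j -> P i k) ->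
  (forall i, exists j, P i j) -> exists j, forall i, P i j.
Proof.
move=> P_mono /choice[b bP]; exists (\max_i b i) => i.
by apply: P_mono (bP i); exact: leq_bigmax.
Qed.

(** The element h is a sum of witnesses, one for each open pair, placed in
    copies with distinct indices. Prescribing that h vanishes below m0 lets
    the induction on s put the next witness at m0 without disturbing the
    others. *)
Lemma avoid_open_fibers n (phi : pp R n.+1) (T : eqType) (psi : T -> pp R n.+1)
    (s : seq T) (N : lmodType R) (inj : forall i, nat -> {linear A i -> N})
    (proj : forall i, nat -> {linear N -> A i}) (m0 : nat) :
  (forall i m z, proj i m (inj i m z) = z) ->
  (forall i i' m m' z, m != m' -> proj i' m' (inj i m z) = 0) ->
  exists h : N, [/\ pp_holds phi (env_cons h (fun=> 0)),
    forall i m, (m < m0)%N -> proj i m h = 0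
    & forall t, t \in s -> ~ closed_pair phi (psi t) -> exists i m,
        (m0 <= m)%N /\ ~ pp_holds (psi t) (env_cons (proj i m h) (fun=> 0))].
Proof.
move=> injK inj_neq; elim: s m0 => [|t s ihs] m0.
  exists 0; split=> // [|i m _]; last by rewrite linear0.
  apply: pp_holds_ext (pp_holds0 _ _); apply: fsym.
  exact: env_cons_ext.
have [h [phih h0 hs]] := ihs m0.+1.
have hE i m : (m <= m0)%N -> proj i m h = 0 by move=> ?; apply: h0.
have [cl|/open_pair_witness[i [z [phiz psiz]]]] := pselect (closed_pair phi (psi t)).
  exists h; split=> // [i m /ltnW|u]; first exact: hE.
  rewrite in_cons => /predU1P[->//|us /(hs u us)[i [m [mm0 psih]]]].
  by exists i, m; split=> //; apply: ltnW.
exists (h + inj i m0 z); split=> [|j m mm0|u].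
- by apply: pp_holds_env_consD => //; apply: pp_holds_linear_fiber.
- by rewrite linearD hE ?(ltnW mm0) // inj_neq ?addr0 // gtn_eqF.
rewrite in_cons => /predU1P[-> _|us /(hs u us)[j [m [mm0 psih]]]].
  by exists i, m0; split=> //; rewrite linearD hE // injK add0r.
exists j, m; split; first exact: ltnW.
by rewrite linearD inj_neq ?addr0 // ltn_eqF.
Qed.

(** A solution of phi(y, b) can be moved out of all the open psi_t: adding h
    from [avoid_open_fibers], taken beyond the supports of y and b, keeps phi,
    and projecting to the copy where h witnesses the failure of psi_t at (h, 0)
    refutes psi_t at (y + h, b). *)
Lemma avoid_open_pairs n (phi : pp R n.+1) (T : eqType) (psi : T -> pp R n.+1)
    (s : seq T) (N : lmodType R) (b : 'I_n -> N) (y : N) :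
  has_free_copies N -> pp_holds phi (env_cons y b) ->
  exists y', pp_holds phi (env_cons y' b) /\
    forall t, t \in s -> ~ closed_pair phi (psi t) ->
      ~ pp_holds (psi t) (env_cons y' b).
Proof.
move=> [inj [proj [injK inj_neq proj_fin]]] phiy.
have [m1 m1P] : exists m1, forall j i m, (m1 <= m)%N ->
    proj i m (env_cons y b j) = 0.
  apply: uniform_bound => [j m m' mm' h i k mk|j]; last exact: proj_fin.
  by apply: h; apply: leq_trans mk.
have [h [phih _ hs]] := avoid_open_fibers phi psi s m1 injK inj_neq.
exists (y + h); split=> [|t ts op psiy]; first exact: pp_holds_env_consD.
have [i [m [m1m]]] := hs t ts op; apply.
have := pp_holds_linear (proj i m) psiy; rewrite linear_env_cons linearD.
rewrite -[y](env_cons0 y b) m1P // add0r.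
congr (pp_holds _ (env_cons _ _)); apply/funext => j /=.
by rewrite -(env_consS y b) m1P.
Qed.

Definition same_pp (T : Type) n (phi : T -> pp R n) (M N : lmodType R)
    (a : 'I_n -> M) (b : 'I_n -> N) : Prop :=
  forall t, pp_holds (phi t) a <-> pp_holds (phi t) b.

(** Semantic form of being equivalent in all ample modules to one and the same
    Boolean combination of finitely many pp formulas; it spares the syntax of
    normal forms. *)
Definition pp_determined n (X : forall M : lmodType R, ('I_n -> M) -> Prop) :
    Prop :=
  exists (T : finType) (phi : T -> pp R n),
    forall (M N : lmodType R) (a : 'I_n -> M) (b : 'I_n -> N),
      ample M -> ample N -> same_pp phi a b -> X M a -> X N b.

Lemma same_pp_sym T n (phi : T -> pp R n) (M N : lmodType R) (a : 'I_n -> M)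
    (b : 'I_n -> N) : same_pp phi a b -> same_pp phi b a.
Proof. by move=> ab t; rewrite ab. Qed.

Lemma pp_determined_not n (X : forall M : lmodType R, ('I_n -> M) -> Prop) :
  pp_determined X -> pp_determined (fun M a => ~ X M a).
Proof.
move=> [T [phi XP]]; exists T, phi => M N a b aM aN ab nXa Xb.
by apply: nXa; apply: XP Xb => //; apply: same_pp_sym.
Qed.

Lemma pp_determined_and n (X Y : forall M : lmodType R, ('I_n -> M) -> Prop) :
  pp_determined X -> pp_determined Y ->
  pp_determined (fun M a => X M a /\ Y M a).
Proof.
move=> [T [phi XP]] [T' [phi' YP]].
exists (T + T')%type, (fun t => match t with inl t => phi t | inr t => phi' t end).
move=> M N a b aM aN ab [Xa Ya]; split.
  by apply: XP Xa => // t; exact: (ab (inl t)).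
by apply: YP Ya => // t; exact: (ab (inr t)).
Qed.

(** If X is determined by the formulas phi t, then (exists x, X) is determined
    by the formulas exists x, theta S, where S ranges over the sets of indices
    and theta S is the conjunction of the phi t, t in S. A witness x for a has
    the set S of formulas true at (x, a); a solution of theta S over b is
    moved out of all open phi t. If phi t is closed and not in S, it cannot
    hold at the new solution, for theta (t |: S) would then be solvable over
    a, and the difference of its solution and x would put t in S. *)
Lemma pp_determined_exists n (X : forall M : lmodType R, ('I_n.+1 -> M) -> Prop) :
  pp_determined X ->
  pp_determined (fun M a => exists x, X M (env_cons x a)).
Proof.
move=> [T [phi XP]].
pose theta (S : {set T}) := pp_conj phi (enum S).
have thetaP S (M : lmodType R) (x : 'I_n.+1 -> M) :
    pp_holds (theta S) x <-> forall t, t \in S -> pp_holds (phi t) x.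
  rewrite pp_holds_conj; split=> h t tS; apply: h; by rewrite mem_enum in tS *.
exists {set T}, (fun S => pp_exists (theta S)) => M N a b aM aN ab [x Xx].
pose S := [set t | `[< pp_holds (phi t) (env_cons x a) >]]%SET.
have SP t : t \in S <-> pp_holds (phi t) (env_cons x a).
  by rewrite inE; split=> /asboolP.
have [y0 Sy0] : exists y, pp_holds (theta S) (env_cons y b).
  by apply/pp_holds_exists/ab/pp_holds_exists; exists x; apply/thetaP => t /SP.
have [y [Sy ynot]] := avoid_open_pairs phi (enum T) aN.2 Sy0.
exists y; apply: XP Xx => // t; split=> [/SP tS|ty].
  by move/thetaP: Sy; apply.
have [cl|/ynot] := pselect (closed_pair (theta S) (phi t)); last first.
  by rewrite mem_enum => /(_ isT).
have [x' /thetaP x'P] : exists x', pp_holds (theta (t |: S)%SET) (env_cons x' a).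
  apply/pp_holds_exists/ab/pp_holds_exists; exists y; apply/thetaP => u.
  by case/setU1P=> [->//|]; move/thetaP: Sy; apply.
have Sx' : pp_holds (theta S) (env_cons x' a).
  by apply/thetaP => u uS; apply: x'P; apply: setU1r.
have Sx : pp_holds (theta S) (env_cons x a) by apply/thetaP => u /SP.
rewrite -(subrKC x' x); apply: pp_holds_env_consD.
  by apply: x'P; apply: setU11.
by apply: (closed_pair_ample aM cl); apply: pp_holds_env_consB Sx Sx'.
Qed.

Lemma pp_determined_ext n (X Y : forall M : lmodType R, ('I_n -> M) -> Prop) :
  (forall M a, X M a <-> Y M a) -> pp_determined X -> pp_determined Y.
Proof.
move=> XY [T [phi XP]]; exists T, phi => M N a b aM aN ab /XY Xa.
by apply/XY; apply: XP Xa.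
Qed.

Fixpoint term_coef n (t : term R n) : 'I_n -> R :=
  match t with
  | Var i => fun j => (i == j)%:R
  | Zero => fun=> 0
  | Plus t1 t2 => fun j => term_coef t1 j + term_coef t2 j
  | Scale r t1 => fun j => r * term_coef t1 j
  end.

Lemma eval_coef n (t : term R n) (M : lmodType R) (e : 'I_n -> M) :
  eval e t = \sum_j term_coef t j *: e j.
Proof.
elim: t => [i||t1 IH1 t2 IH2|r t IH] /=.
- rewrite (bigD1 i) //= eqxx scale1r big1 ?addr0 // => j /negPf ji.
  by rewrite eq_sym ji scale0r.
- by rewrite big1 // => j _; rewrite scale0r.
- by under eq_bigr do rewrite scalerDl; rewrite big_split /= IH1 IH2.
- by under eq_bigr do rewrite -scalerA; rewrite -scaler_sumr IH.
Qed.

Lemma pp_determined_equal n (t1 t2 : term R n) :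
  pp_determined (fun M e => eval e t1 = eval e t2).
Proof.
pose phi : pp R n := PP (0 : 'M_(1, 0)) (\row_j (term_coef t1 j - term_coef t2 j)).
exists unit, (fun=> phi) => M N a b _ _ /(_ tt).
have phiP (M' : lmodType R) (e : 'I_n -> M') :
    pp_holds phi e <-> eval e t1 = eval e t2.
  have sumE i : \sum_j pp_rhs phi i j *: e j = eval e t1 - eval e t2.
    rewrite !eval_coef -sumrB; apply: eq_bigr => j _.
    by rewrite mxE scalerBl.
  split=> [[y /(_ ord0)]|e12].
    by rewrite sumE big_ord0 => /esym/eqP; rewrite subr_eq0 => /eqP.
  by exists (fun=> 0) => i; rewrite sumE e12 subrr big_ord0.
by rewrite !phiP => -[].
Qed.

Lemma formula_pp_determined n (f : formula R n) :
  pp_determined (fun M => @holds R M n f).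
Proof.
elim: f => {n} /=.
- exact: pp_determined_equal.
- by move=> n f; exact: pp_determined_not.
- by move=> n f IHf g IHg; exact: pp_determined_and.
- move=> n f /pp_determined_not IHf g /pp_determined_not IHg.
  apply: pp_determined_ext (pp_determined_not (pp_determined_and IHf IHg)).
  by move=> M a; rewrite not_andE !notE.
- by move=> n f; exact: pp_determined_exists.
- move=> n f /pp_determined_not/pp_determined_exists/pp_determined_not.
  apply: pp_determined_ext => M a; split=> [h x|h [x]]; last by apply.
  by apply: contrapT => fx; apply: h; exists x.
Qed.

Lemma ample_elementarily_equivalent (M N : lmodType R) :
  ample M -> ample N -> is_model (complete_theory M) N.
Proof.
move=> aM aN s; have [T [phi sP]] := formula_pp_determined s.
by apply: sP => // t; split=> _; [apply: pp_holds_ext (pp_holds0 _ _) => -[]..].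
Qed.

End Elimination.

(** * Limits of countable chains *)

Section Chain.
Variables (R : pzRingType) (X : nat -> lmodType R).
Variable g : forall i, {linear X i -> X i.+1}.

(** Taking 0 for j < i makes the composite of the g total in i and j, which
    avoids casts between X i and X (k + i) and turns an element of any stage
    into a sequence over all the stages. *)
Fixpoint transition i j : X i -> X j :=
  match j return X i -> X j with
  | 0 => match i =P 0%N with
         | ReflectT e => fun x => ecast k (X k) e x
         | ReflectF _ => fun=> 0
         end
  | j'.+1 => match i =P j'.+1 with
             | ReflectT e => fun x => ecast k (X k) e x
             | ReflectF _ => fun x => g j' (transition j' x)
             end
  end.

Lemma transition_id i x : @transition i i x = x.
Proof. by case: i x => [|i] x /=; case: eqP => // e; rewrite eq_axiomK. Qed.

Lemma transitionS i j (x : X i) : (i <= j)%N ->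
  transition j.+1 x = g j (transition j x).
Proof. by move=> ij /=; case: eqP => // e; exfalso; rewrite e ltnn in ij. Qed.

Fact transition_linear i j : linear (@transition i j).
Proof.
elim: j => [|j ihj] r x y /=.
  by case: eqP => [e|_]; [case: _ / e | rewrite scaler0 addr0].
case: eqP => [e|_]; first by case: _ / e.
by rewrite ihj linearP.
Qed.
HB.instance Definition _ i j := GRing.isLinear.Build R (X i) (X j) *:%R
  (@transition i j) (@transition_linear i j).

Lemma transition_step i j (x : X i) : (i < j)%N ->
  transition j (g i x) = transition j x.
Proof.
elim: j => // j ihj; rewrite ltnS leq_eqVlt => /predU1P[ij|ij].
  by subst j; rewrite transition_id transitionS // transition_id.
by rewrite !transitionS ?ihj // ltnW.
Qed.

Lemma transition_comp i j k (x : X i) : (i <= j)%N -> (j <= k)%N ->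
  transition k (transition j x) = transition k x.
Proof.
move=> ij; elim: k => [|k ihk].
  by rewrite leqn0 => /eqP j0; subst j; rewrite transition_id.
rewrite leq_eqVlt => /predU1P[jk|jk]; first by subst j; rewrite transition_id.
by rewrite !transitionS ?ihk //; exact: leq_trans ij jk.
Qed.

Definition is_universal_cocone (B : lmodType R) (u : forall i, {linear X i -> B}) :=
  forall (N : lmodType R) (v : forall i, {linear X i -> N}),
    is_chain_cocone g v ->
    exists w : {linear B -> N},
      (forall i x, w (u i x) = v i x) /\
      (forall w' : {linear B -> N},
         (forall i x, w' (u i x) = v i x) -> w' =1 w).

Section Limit.
Variables (B : lmodType R) (u : forall i, {linear X i -> B}).
Hypothesis u_cocone : is_chain_cocone g u.
Hypothesis u_universal : is_universal_cocone u.

Lemma cocone_transition i j (x : X i) : (i <= j)%N -> u j (transition j x) = u i x.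
Proof.
elim: j => [|j ihj].
  by rewrite leqn0 => /eqP i0; subst i; rewrite transition_id.
rewrite leq_eqVlt => /predU1P[ij|ij]; first by subst i; rewrite transition_id.
by rewrite transitionS // u_cocone ihj.
Qed.

(** The images of the stages form a submodule. The universal map to it, composed
    with the inclusion, is the identity of B by uniqueness. *)
Lemma chain_limit_surj b : exists i x, u i x = b.
Proof.
pose P b := exists i x, u i x = b.
have subP : is_submodule P.
  split; first by exists 0%N, 0; rewrite linear0.
  move=> r x y [i [x' <-]] [j [y' <-]].
  exists (maxn i j), (r *: transition (maxn i j) x' + transition (maxn i j) y').
  by rewrite linearP !cocone_transition ?leq_maxl ?leq_maxr.
have Pu i x : P (u i x) by exists i, x.
pose v i := [the {linear _ -> _} of corestrict subP (Pu i)].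
have v_cocone : is_chain_cocone g v.
  by move=> i x; apply: submodule_val_inj; exact: u_cocone.
have [w [wE _]] := u_universal v_cocone.
have [w0 [_ w0_uniq]] := u_universal u_cocone.
suff -> : b = submodule_val (w b) by exact: (submoduleP (w b)).
rewrite [LHS](w0_uniq [the {linear _ -> _} of idfun] (fun _ _ => erefl) b).
apply/esym/(w0_uniq [the {linear _ -> _} of submodule_incl subP \o w]) => i x.
by rewrite /= wE.
Qed.

(** Test the universal property on the product of all the stages modulo the
    sequences that are eventually 0: an element x of stage i is mapped to the
    class of its sequence of transitions, which is 0 only if these are
    eventually 0. *)
Lemma chain_limit_eq0 i x : u i x = 0 -> exists j, (i <= j)%N /\ transition j x = 0.
Proof.
move=> ux0.
pose P (f : dprod X) := exists m, forall j, (m <= j)%N -> f j = 0.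
have subP : is_submodule P.
  split; first by exists 0%N.
  move=> r f f' [m fm] [m' fm']; exists (maxn m m') => j.
  rewrite geq_max => /andP[mj m'j].
  by rewrite -[LHS]/(r *: f j + f' j) fm // fm' // scaler0 addr0.
pose s k (y : X k) : dprod X := fun j => transition j y.
have s_lin k : linear (@s k).
  by move=> r y z; apply: functional_extensionality_dep => j; exact: linearP.
pose v k : {linear X k -> quotient subP} :=
  [the {linear _ -> _} of quotient_mk subP \o linear_of (s_lin k)].
have v_cocone : is_chain_cocone g v.
  move=> k y; apply: quotient_mk_eq; exists k.+1 => j kj.
  by rewrite -[LHS]/(transition j (g k y) - transition j y) transition_step ?subrr.
have [w [wE _]] := u_universal v_cocone.
have /quotient_mk_eq0[m xm] : quotient_mk subP (s i x) = 0.
  by rewrite -[LHS]/(v i x) -wE ux0 linear0.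
exists (maxn i m); split; first exact: leq_maxl.
by apply: xm; exact: leq_maxr.
Qed.

(** The finitely many witnesses come from a common stage, and the finitely many
    equations, being true in the limit, become true at a later one. *)
Lemma pp_holds_chain_limit n (phi : pp R n) i (x : 'I_n -> X i) :
  pp_holds phi (u i \o x) -> exists j, (i <= j)%N /\
    pp_holds phi (fun k => transition j (x k)).
Proof.
move=> [y yE].
have [k kP] : exists k, forall t, (i <= k)%N /\ exists z : X k, u k z = y t.
  have [|t|k kP] := @uniform_bound _
      (fun t k => (i <= k)%N /\ exists z : X k, u k z = y t); last by exists k.
    move=> t j k jk [ij [z <-]]; split; first exact: leq_trans jk.
    by exists (transition k z); rewrite cocone_transition.
  have [k [z zE]] := chain_limit_surj (y t).
  exists (maxn i k); split; first exact: leq_maxl.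
  by exists (transition (maxn i k) z); rewrite cocone_transition ?leq_maxr.
pose k' := maxn i k.
have ik' : (i <= k')%N := leq_maxl _ _.
have /choice[z zE] t : exists z : X k', u k' z = y t.
  have [ik [z <-]] := kP t.
  by exists (transition k' z); rewrite cocone_transition ?leq_maxr.
pose d e := \sum_j pp_lhs phi e j *: z j -
  \sum_j pp_rhs phi e j *: transition k' (x j).
have ud e : u k' (d e) = 0.
rewrite linearB [X in X - _]linear_sum [X in _ - X]linear_sum; apply/eqP.
  rewrite subr_eq0; apply/eqP.
  under eq_bigr do rewrite linearZ /= zE.
  under [RHS]eq_bigr do rewrite linearZ /= cocone_transition //.
  exact: yE.
have [m mP] : exists m, forall e, (k' <= m)%N /\ transition m (d e) = 0.
  apply: uniform_bound => [e j m jm [kj de]|e].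
    split; first exact: leq_trans jm.
    by rewrite -(transition_comp _ kj jm) de linear0.
  exact: chain_limit_eq0.
pose m' := maxn k' m; have km' : (k' <= m')%N := leq_maxl _ _.
exists m'; split; first exact: leq_trans km'.
exists (fun j => transition m' (z j)) => e.
have [km de] := mP e.
have : transition m' (d e) = 0.
  by rewrite -(transition_comp _ km (leq_maxr _ _)) de linear0.
rewrite linearB [X in X - _]linear_sum [X in _ - X]linear_sum => /eqP.
rewrite subr_eq0 => /eqP.
under eq_bigr do rewrite linearZ.
under [X in _ = X -> _]eq_bigr do rewrite linearZ /= transition_comp //.
by [].
Qed.

Lemma chain_limit_pp_implies n (phi psi : pp R n) :
  (forall i, pp_implies (X i) phi psi) -> pp_implies B phi psi.
Proof.
move=> X_imp x phix.
have [k kP] : exists k, forall t, exists z : X k, u k z = x t.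
  apply: uniform_bound => [t j k jk [z <-]|t]; last exact: chain_limit_surj.
  by exists (transition k z); rewrite cocone_transition.
have /choice[z zE] := kP.
have xE : x = u k \o z by apply/funext => t; rewrite /= zE.
move: phix; rewrite xE => /pp_holds_chain_limit[j [kj /X_imp psix]].
apply: pp_holds_ext (pp_holds_linear (u j) psix) => t /=.
by rewrite cocone_transition.
Qed.

End Limit.
End Chain.

(** * The direct sum F and its extensions are ample *)

Section PPImplications.
Variable R : pzRingType.

Lemma pp_implies_direct_sum (J : Type) (M : J -> lmodType R) n
    (phi psi : pp R n) :
  (forall j, pp_implies (M j) phi psi) -> pp_implies (direct_sum M) phi psi.
Proof.
move=> M_imp x phix; have [s [us sP]] := dsum_support_tuple x.
have /pp_holds_sum-/(_ s) : forall p : {classic J},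
    pp_holds psi (@dsum_inj _ J M p \o (@dsum_coord _ J M p \o x)).
  move=> p; apply/(pp_holds_linear (@dsum_inj _ J M p))/M_imp.
  exact: (pp_holds_linear (@dsum_coord _ J M p)).
apply: pp_holds_ext => j /=; apply/esym.
exact: (@dsum_decomp _ {classic J} M (x j) s us (sP j)).
Qed.

Lemma pp_implies_oplus (M N : lmodType R) n (phi psi : pp R n) :
  pp_implies M phi psi -> pp_implies N phi psi ->
  pp_implies (oplus M N) phi psi.
Proof.
move=> M_imp N_imp x phix.
have psi1 := pp_holds_linear (@oplus_inl _ M N)
  (M_imp _ (pp_holds_linear (@oplus_fst _ M N) phix)).
have psi2 := pp_holds_linear (@oplus_inr _ M N)
  (N_imp _ (pp_holds_linear (@oplus_snd _ M N) phix)).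
by apply: pp_holds_ext (pp_holdsD psi1 psi2) => j /=; rewrite -oplus_decomp.
Qed.

Lemma pp_implies_add (I : Type) (A : I -> lmodType R) (M : lmodType R) n
    (phi psi : pp R n) :
  add_class (family_class A) M -> (forall i, pp_implies (A i) phi psi) ->
  pp_implies M phi psi.
Proof.
move=> /add_classP[T [X [inj [proj [XA injK]]]]] A_imp x phix.
have X_imp t : pp_implies (X t) phi psi by have [i ->] := XA t.
have /pp_holds_sum-/(_ (index_enum T)) :
    forall t, pp_holds psi (inj t \o (proj t \o x)).
  move=> t; apply/(pp_holds_linear (inj t))/X_imp.
  exact: (pp_holds_linear (proj t)).
by apply: pp_holds_ext => j /=; rewrite -injK.
Qed.

End PPImplications.

Section Ample.
Variables (R : pzRingType) (I : Type) (A : I -> lmodType R).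

Lemma F_inherits : inherits_pp_implications A (F_ A).
Proof. by move=> n phi psi A_imp; apply: pp_implies_direct_sum => p. Qed.

Lemma F_has_free_copies : has_free_copies A (F_ A).
Proof.
pose AA (p : I * nat) := A p.1.
exists (fun i m =>
  [the {linear AA (i, m) -> direct_sum AA} of @dsum_inj _ _ AA (i, m)]).
exists (fun i m =>
  [the {linear direct_sum AA -> AA (i, m)} of @dsum_coord _ _ AA (i, m)]).
split=> [i m z|i i' m m' z mm'|f]; first exact: (@dsum_injE _ _ AA (i, m)).
  have ne : (i, m) <> (i', m') by case=> _ /eqP; apply/negP.
  exact: (@dsum_inj_neq _ _ AA (i, m) (i', m') z ne).
have [s [_ sP]] := dsum_support f.
exists (\max_(p <- s) (p : I * nat).2).+1 => i m ms.
apply: contrapT => /= fim; move: ms; apply/negP; rewrite -leqNgt.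
exact: (@leq_bigmax_seq {classic I * nat} s predT (fun p : I * nat => p.2)
          (i, m) (sP (i, m) fim)).
Qed.

Lemma ample_F : ample A (F_ A).
Proof. by split; [exact: F_inherits | exact: F_has_free_copies]. Qed.

Lemma ample_F_oplus (B : lmodType R) :
  inherits_pp_implications A B -> ample A (oplus (F_ A) B).
Proof.
move=> inB; split=> [n phi psi A_imp|].
  by apply: pp_implies_oplus; [exact: F_inherits | exact: inB].
have [inj [proj [injK inj_neq proj_fin]]] := F_has_free_copies.
exists (fun i m => [the {linear _ -> _} of @oplus_inl _ (F_ A) B \o inj i m]).
exists (fun i m => [the {linear _ -> _} of proj i m \o @oplus_fst _ (F_ A) B]).
split=> [i m z|i i' m m' z mm'|x]; first exact: injK.
  exact: inj_neq.
exact: proj_fin.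
Qed.

End Ample.

(** * A direct sum plus a chain limit as a direct limit *)

Section FinitePart.
Variables (R : pzRingType) (J : Type) (M : J -> lmodType R).

Definition supported_in (s : set J) (f : direct_sum M) : Prop :=
  forall p, ~ s p -> dsum_val f p = 0.

Lemma supported_in_submodule (s : set J) : is_submodule (supported_in s).
Proof.
split=> [//|r f g fs gs p sp].
by rewrite -[LHS]/(r *: dsum_val f p + dsum_val g p) fs // gs // scaler0 addr0.
Qed.

Definition dsum_part (s : set J) : lmodType R :=
  submodule (supported_in_submodule s).

Lemma dsum_part_add (K : module_class R) (s : set J) :
  (forall j, K (M j)) -> finite_set s -> add_class K (dsum_part s).
Proof.
move=> KM /(@finite_seqP {classic J})[s' sE].
pose s0 : seq {classic J} := @undup {classic J} s'.
have s0P p : s p <-> p \in s0 by rewrite (@mem_undup {classic J}) sE.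
pose e (t : 'I_(size s0)) : J := tnth (in_tuple s0) t.
have inj_in t z : supported_in s (@dsum_inj R J M (e t) z).
  move=> p sp; apply: dsum_inj_neq => ep; apply: sp; apply/s0P.
  by rewrite -ep; exact: mem_tnth.
apply/add_classP; exists 'I_(size s0), (M \o e).
exists (fun t => [the {linear _ -> _} of
  corestrict (supported_in_submodule s) (inj_in t)]).
exists (fun t => [the {linear _ -> _} of
  @dsum_coord R J M (e t) \o submodule_incl (supported_in_submodule s)]).
split=> [t|x]; first exact: KM.
apply: submodule_val_inj; rewrite -[RHS]/(submodule_incl _ _) linear_sum.
have xs p : dsum_val (submodule_val x) p <> 0 -> p \in s0.
  move=> xp; apply/s0P; apply: contrapT => sp; apply: xp.
  exact: (submoduleP x).
rewrite [LHS](@dsum_decomp _ {classic J} M _ s0 (@undup_uniq {classic J} _) xs).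
rewrite big_tnth; apply: eq_bigr => t _.
by [].
Qed.

End FinitePart.

(** A direct sum plus the limit of a chain is the limit of the sums of a finite
    part of the former and a stage of the latter. *)
Section SumPlusChain.
Variables (R : pzRingType) (J : Type) (M : J -> lmodType R).
Variables (X : nat -> lmodType R) (g : forall i, {linear X i -> X i.+1}).

(** The indices are sets, not lists, because the order of a direct system is
    antisymmetric. *)
Definition stage : Type := {s : set J | finite_set s} * nat.

Definition stage_le (a b : stage) : Prop :=
  (sval a.1 `<=` sval b.1)%classic /\ (a.2 <= b.2)%N.

Fact stage_le_refl a : stage_le a a. Proof. by split. Qed.

Fact stage_le_antisym a b : stage_le a b -> stage_le b a -> a = b.
Proof.
case: a b => [[s fs] i] [[t ft] j] [/= st ij] [/= ts ji].
have e : s = t by apply/seteqP; split.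
subst t; rewrite (Prop_irrelevance ft fs).
by congr (_, _); apply/eqP; rewrite eqn_leq ij ji.
Qed.

Fact stage_le_trans a b c : stage_le a b -> stage_le b c -> stage_le a c.
Proof.
by move=> [ab abn] [bc bcn]; split; [exact: subset_trans bc|exact: leq_trans bcn].
Qed.

Definition stage0 : stage := (exist _ _ (finite_set0 J), 0%N).

Fact finite_union (s t : set J) :
  finite_set s -> finite_set t -> finite_set (s `|` t)%classic.
Proof. by rewrite finite_setU. Qed.

Definition stage_join (a b : stage) : stage :=
  (exist _ (sval a.1 `|` sval b.1)%classic
     (finite_union (svalP a.1) (svalP b.1)),
   maxn a.2 b.2).

Lemma stage_le_joinl a b : stage_le a (stage_join a b).
Proof. by split; [exact: subsetUl | exact: leq_maxl]. Qed.

Lemma stage_le_joinr a b : stage_le b (stage_join a b).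
Proof. by split; [exact: subsetUr | exact: leq_maxr]. Qed.

Definition stage_obj (a : stage) : lmodType R :=
  oplus (dsum_part M (sval a.1)) (X a.2).

Lemma supported_in_widen (s t : set J) (f : dsum_part M s) :
  (s `<=` t)%classic -> supported_in t (submodule_incl _ f).
Proof. by move=> st p tp; apply: (submoduleP f); move/st. Qed.

Definition stage_map (a b : stage) (le_ab : stage_le a b) :
    {linear stage_obj a -> stage_obj b} :=
  [the {linear _ -> _} of oplus_map
    [the {linear _ -> _} of corestrict (supported_in_submodule M (sval b.1))
       (fun f => supported_in_widen f le_ab.1)]
    [the {linear _ -> _} of @transition R X g a.2 b.2]].

Fact stage_map_id a (le_aa : stage_le a a) x : stage_map le_aa x = x.
Proof.
case: x => f x; apply/pair_equal_spec; split; first exact: submodule_val_inj.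
exact: transition_id.
Qed.

Fact stage_map_comp a b c (le_ab : stage_le a b) (le_bc : stage_le b c)
    (le_ac : stage_le a c) x :
  stage_map le_bc (stage_map le_ab x) = stage_map le_ac x.
Proof.
case: x => f x; apply/pair_equal_spec; split; first exact: submodule_val_inj.
exact: transition_comp le_ab.2 le_bc.2.
Qed.

Definition stage_system : direct_system R :=
  @DirectSystem R stage stage_le stage_le_refl stage_le_antisym stage_le_trans
    (inhabits stage0)
    (fun a b => ex_intro _ (stage_join a b)
       (conj (stage_le_joinl a b) (stage_le_joinr a b)))
    stage_obj stage_map stage_map_id stage_map_comp.

Variables (B : lmodType R) (u : forall i, {linear X i -> B}).
Hypothesis u_cocone : is_chain_cocone g u.
Hypothesis u_universal : is_universal_cocone g u.

Definition stage_cocone (a : stage) :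
    {linear stage_obj a -> oplus (direct_sum M) B} :=
  [the {linear _ -> _} of oplus_map
     [the {linear _ -> _} of submodule_incl (supported_in_submodule M (sval a.1))]
     (u a.2)].

Section Factor.
Variables (N : lmodType R) (v : forall a, {linear stage_obj a -> N}).
Hypothesis v_cocone : @is_cocone R stage_system N v.

Let v_inl (a b : stage) (x : dsum_part M (sval a.1)) (y : dsum_part M (sval b.1)) :
  submodule_val x = submodule_val y -> v a (x, 0) = v b (y, 0).
Proof.
move=> xy; rewrite -(v_cocone (stage_le_joinl a b)) -(v_cocone (stage_le_joinr a b)).
congr (v _ _); apply/pair_equal_spec; split; first exact: submodule_val_inj.
by rewrite !linear0.
Qed.

Let support_stage (f : direct_sum M) : stage :=
  (exist _ _ (asboolW (valP f)), 0%N).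

Let support_in (f : direct_sum M) : supported_in (sval (support_stage f).1) f.
Proof. by move=> p /contrapT. Qed.

(* On the direct sum the factorization is computed at the support of f; by
   [v_inl] any stage that contains f gives the same value. *)
Let w1 (f : direct_sum M) : N :=
  v (support_stage f) (in_submodule _ (@support_in f), 0).

Let w1E a (x : dsum_part M (sval a.1)) : w1 (submodule_val x) = v a (x, 0).
Proof. exact: v_inl. Qed.

Fact factor_sum_linear : linear w1.
Proof.
move=> r x y; pose a := stage_join (support_stage x) (support_stage y).
have xa : supported_in (sval a.1) x.
  by move=> p ap; apply: support_in => sp; apply: ap; left.
have ya : supported_in (sval a.1) y.
  by move=> p ap; apply: support_in => sp; apply: ap; right.
pose x' : dsum_part M (sval a.1) := in_submodule _ xa.
pose y' : dsum_part M (sval a.1) := in_submodule _ ya.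
rewrite -[r *: x + y]/(submodule_val (r *: x' + y')).
rewrite -[x in RHS]/(submodule_val x') -[y in RHS]/(submodule_val y') !w1E -linearP.
by congr (v a _); apply/pair_equal_spec; rewrite /= scaler0 addr0.
Qed.

Lemma stage_factor :
  exists w : {linear oplus (direct_sum M) B -> N},
    (forall a x, w (stage_cocone a x) = v a x) /\
    (forall w' : {linear oplus (direct_sum M) B -> N},
      (forall a x, w' (stage_cocone a x) = v a x) -> w' =1 w).
Proof.
pose v2 i : {linear X i -> N} :=
  [the {linear _ -> _} of v (stage0.1, i) \o @oplus_inr _ _ (X i)].
have v2E a (y : X a.2) : v a (0, y) = v2 a.2 y.
  have le : stage_le (stage0.1, a.2) a by split=> //= p [].
  rewrite /= -(v_cocone le); congr (v a _); apply/pair_equal_spec; split.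
    exact/esym/linear0.
  exact/esym/transition_id.
have v2_cocone : is_chain_cocone g v2.
  move=> i x; have le : stage_le (stage0.1, i) (stage0.1, i.+1) by split=> //=.
  rewrite /= -(v_cocone le); congr (v _ _); apply/pair_equal_spec; split.
    exact/esym/linear0.
  by rewrite -[RHS]/(transition g i.+1 x) transitionS // transition_id.
have [w2 [w2E w2_uniq]] := u_universal v2_cocone.
have w_lin : linear (fun z : oplus (direct_sum M) B => w1 z.1 + w2 z.2).
  by move=> r x y; rewrite factor_sum_linear linearP scalerDr addrACA.
exists (linear_of w_lin); split=> [a [x y]|w' w'E [f b]].
  rewrite -[LHS]/(w1 (submodule_val x) + w2 (u a.2 y)) w1E w2E -v2E -linearD.
  by congr (v a _); apply/pair_equal_spec; rewrite addr0 add0r.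
rewrite {1}[(f, b)]oplus_decomp linearD -[RHS]/(w1 f + w2 b).
congr (_ + _).
  rewrite /w1 -w'E; congr (w' _); apply/pair_equal_spec; split=> //.
  exact/esym/linear0.
apply: (w2_uniq [the {linear _ -> _} of w' \o @oplus_inr _ (direct_sum M) B]).
by move=> i x; rewrite /= -w'E.
Qed.

End Factor.

Lemma stage_system_limit : is_direct_limit stage_system (oplus (direct_sum M) B).
Proof.
exists stage_cocone; split; last exact: stage_factor.
move=> a b le_ab [x y]; apply/pair_equal_spec; split=> //=.
exact: (cocone_transition u_cocone _ le_ab.2).
Qed.

End SumPlusChain.

Lemma direct_limits_oplus (R : pzRingType) (J : Type) (M : J -> lmodType R)
    (K : module_class R) (X : nat -> lmodType R)
    (g : forall i, {linear X i -> X i.+1}) (B : lmodType R) :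
  (forall j, K (M j)) -> (forall i, add_class K (X i)) -> is_chain_limit g B ->
  direct_limits (add_class K) (oplus (direct_sum M) B).
Proof.
move=> KM KX [u [u_cocone u_universal]].
exists (stage_system M g); split; last exact: stage_system_limit u_cocone u_universal.
move=> [[s fs] i]; apply: add_class_oplus (KX i).
exact: dsum_part_add.
Qed.

(** * The Mittag-Leffler property *)

Section MittagLeffler.
Variable R : pzRingType.

Lemma linear_factor (U M N : lmodType R) (p : {linear U -> M})
    (h : {linear U -> N}) :
  (forall x, exists v, p v = x) -> (forall v, p v = 0 -> h v = 0) ->
  exists f : {linear M -> N}, forall v, f (p v) = h v.
Proof.
move=> /choice[s sK] kerP.
have hE v v' : p v = p v' -> h v = h v'.
  move=> pv; apply/eqP; rewrite -subr_eq0 -linearB kerP //.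
  by rewrite linearB pv subrr.
have f_lin : linear (h \o s).
  by move=> r x y; rewrite -linearP; apply: hE; rewrite linearP !sK.
by exists (linear_of f_lin) => v; apply: hE; rewrite sK.
Qed.

(** The formula that generates the pp type of the tuple V in the module with
    relation matrix D. *)
Definition pp_presented m n k (D : 'M[R]_(m, n)) (V : 'M[R]_(k, n)) : pp R k :=
  PP (col_mx D V) (col_mx 0 1%:M).

Lemma pp_holds_presented m n k (D : 'M[R]_(m, n)) (V : 'M[R]_(k, n))
    (M : lmodType R) (x : 'I_k -> M) :
  pp_holds (pp_presented D V) x <-> exists y : 'I_n -> M,
    (forall e, \sum_i D e i *: y i = 0) /\
    (forall j, \sum_i V j i *: y i = x j).
Proof.
have sum0 i : \sum_j (col_mx 0 1%:M : 'M[R]_(m + k, k)) (lshift k i) j *: x j = 0.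
  by rewrite big1 // => j _; rewrite col_mxEu mxE scale0r.
have sum1 i : \sum_j (col_mx 0 1%:M : 'M[R]_(m + k, k)) (rshift m i) j *: x j = x i.
  rewrite (bigD1 i) //= col_mxEd mxE eqxx scale1r big1 ?addr0 // => j /negPf ji.
  by rewrite col_mxEd mxE eq_sym ji scale0r.
split=> [[y yE]|[y [Dy Vy]]].
  exists y; split=> [e|j].
    have := yE (lshift _ e); rewrite sum0 => h; rewrite -[RHS]h.
    by apply: eq_bigr => i _; rewrite col_mxEu.
  have := yE (rshift _ j); rewrite sum1 => <-.
  by apply: eq_bigr => i _; rewrite col_mxEd.
exists y => i /=; have [e ->|j ->] := split_ordP i.
  by rewrite sum0 -[RHS](Dy e); apply: eq_bigr => j _; rewrite col_mxEu.
by rewrite sum1 -(Vy j); apply: eq_bigr => i' _; rewrite col_mxEd.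
Qed.

(** If V expresses the tuple in the generators of M and D is the relation
    matrix, then [pp_presented D V] generates the pp type: a tuple satisfying
    it in N is the image of the given one under a homomorphism, defined on the
    generators by the witnesses. *)
Lemma finitely_presented_mittag_leffler (M : lmodType R) :
  finitely_presented M -> mittag_leffler M.
Proof.
move=> [m [n [D [p [p_surj p_ker]]]]] k a.
have /choice[v vE] j := p_surj (a j).
pose V := \matrix_(j < k, i < n) v j 0 i.
have sum_p (w : 'rV[R]_n) : \sum_i w 0 i *: p (delta_mx 0 i) = p w.
  rewrite [in RHS](row_sum_delta w) linear_sum; apply: eq_bigr => i _.
  by rewrite linearZ.
exists (pp_presented D V); split.
  apply/pp_holds_presented; exists (fun i => p (delta_mx 0 i)); split=> [e|j].
    transitivity (p (row e D)).
      by rewrite -sum_p; apply: eq_bigr => i _; rewrite mxE.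
    by apply/p_ker; exists (delta_mx 0 e); exact: rowE.
  by rewrite -vE -sum_p; apply: eq_bigr => i _; rewrite mxE.
move=> psi psia N b /pp_holds_presented[y [Dy Vy]].
pose h (w : 'rV[R]_n) := \sum_i w 0 i *: y i.
have h_lin : linear h.
  move=> r w w'; rewrite scaler_sumr -big_split /=; apply: eq_bigr => i _.
  by rewrite !mxE scalerDl scalerA.
have [w /p_ker[w' ->]|f fE] := @linear_factor _ _ _ p (linear_of h_lin) p_surj.
  rewrite -[LHS]/(\sum_i (w' *m D) 0 i *: y i).
  under eq_bigr do rewrite mxE scaler_suml.
  rewrite exchange_big big1 // => e _.
  under eq_bigr do rewrite -scalerA.
  by rewrite -scaler_sumr Dy scaler0.
apply: pp_holds_ext (pp_holds_linear f psia) => j /=.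
by rewrite -vE fE -Vy; apply: eq_bigr => i _; rewrite mxE.
Qed.

Lemma mittag_leffler_retract (M D : lmodType R) :
  direct_summand M D -> mittag_leffler D -> mittag_leffler M.
Proof.
move=> /retract_direct_summand[i [p iK]] mlD n a.
have [phi [phia phi_le]] := mlD n (i \o a).
exists phi; split=> [|psi psia].
  by apply: pp_holds_ext (pp_holds_linear p phia) => j /=; rewrite iK.
by apply: phi_le; exact: pp_holds_linear.
Qed.

(** The pp type of a tuple is generated by the sum, over the finite support, of
    generators of the pp types of its coordinates: sums of pp formulas are
    least upper bounds because pp formulas define subgroups. *)
Lemma mittag_leffler_direct_sum (J : Type) (M : J -> lmodType R) :
  (forall j, mittag_leffler (M j)) -> mittag_leffler (direct_sum M).
Proof.
move=> mlM n a; have [s [us sP]] := dsum_support_tuple a.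
pose coord (p : {classic J}) := @dsum_coord R J M p.
pose inj (p : {classic J}) := @dsum_inj R J M p.
have /choice[phi phiP] p := mlM p n (coord p \o a).
exists (pp_sum phi s); split.
  have /pp_holds_pp_sum-/(_ s) : forall p, pp_holds (phi p) (inj p \o (coord p \o a)).
    by move=> p; apply: (pp_holds_linear (@dsum_inj R J M p)); exact: (phiP p).1.
  apply: pp_holds_ext => j /=; apply/esym.
  exact: (@dsum_decomp _ {classic J} M (a j) s us (sP j)).
move=> psi psia; apply: pp_sum_le => p; apply: (phiP p).2.
exact: (pp_holds_linear (@dsum_coord R J M p)).
Qed.

Lemma pure_projective_mittag_leffler (M : lmodType R) :
  pure_projective M -> mittag_leffler M.
Proof.
move=> [J [X [X_fp /mittag_leffler_retract]]]; apply.
by apply: mittag_leffler_direct_sum => j; exact: finitely_presented_mittag_leffler.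
Qed.

(** A generator of the pp type of the common image of the a_i in B lies below
    every Phi i, and above Phi m as soon as it holds at stage m. *)
Lemma bass_module_not_mittag_leffler (K : module_class R) n (Phi : nat -> pp R n)
    (B : lmodType R) :
  descending Phi -> is_bass_module K Phi B -> ~ stabilizes Phi ->
  ~ mittag_leffler B.
Proof.
move=> Phi_desc [X [a [g [_ a_free ga [u [u_cocone u_universal]]]]]] unstable mlB.
have tr_a j t : transition g j (a 0%N t) = a j t.
  by elim: j => [|j ihj]; rewrite ?transition_id // transitionS // ihj ga.
have [phi [phib phi_le]] := mlB n (u 0%N \o a 0%N).
have [m [_ phi_am]] := pp_holds_chain_limit u_cocone u_universal phib.
have le_phi : pp_le (Phi m) phi.
  move=> N b /(a_free m).2[f fE].
  by apply: pp_holds_ext (pp_holds_linear f phi_am) => t /=; rewrite tr_a.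
have phi_le_Phi i : pp_le phi (Phi i).
  apply: phi_le; apply: pp_holds_ext (pp_holds_linear (u i) (a_free i).1) => t /=.
  by rewrite -tr_a (cocone_transition u_cocone).
apply: unstable; exists m => i mi M x; split=> [|/le_phi]; last exact: phi_le_Phi.
elim: i mi => [|i ihi]; first by rewrite leqn0 => /eqP->.
rewrite leq_eqVlt => /predU1P[->//|mi] /Phi_desc; exact: ihi.
Qed.

End MittagLeffler.

Theorem lemma10 (R : pzRingType) (I : Type) (A : I -> lmodType R)
    (A_fp : forall i, finitely_presented (A i))
    (n : nat) (Phi : nat -> pp R n)
    (Phi_desc : descending Phi)
    (Phi_Gamma : forall i, Gamma (add_class (family_class A)) (Phi i))
    (B : lmodType R)
    (B_bass : is_bass_module (add_class (family_class A)) Phi B) :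
  is_model (T_ A) (oplus (F_ A) B) /\
  (~ stabilizes Phi ->
     [/\ class_model (direct_limits (add_class (family_class A))) (T_ A)
           (oplus (F_ A) B),
         ~ mittag_leffler (oplus (F_ A) B)
       & ~ pure_projective (oplus (F_ A) B)]).
Proof.
have [X [a [g [XA _ _ B_limit]]]] := B_bass.
have [u [u_cocone u_universal]] := B_limit.
have F_B_model : is_model (T_ A) (oplus (F_ A) B).
  apply: (ample_elementarily_equivalent (ample_F A)); apply: ample_F_oplus.
  move=> k phi psi A_imp.
  apply: (chain_limit_pp_implies u_cocone u_universal) => i.
  exact: pp_implies_add (XA i).1 A_imp.
split=> // unstable.
have not_ml : ~ mittag_leffler (oplus (F_ A) B).
  move=> ml; apply: (bass_module_not_mittag_leffler Phi_desc B_bass unstable).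
  apply: mittag_leffler_retract ml.
  apply: (direct_summand_retract (i := [the {linear _ -> _} of @oplus_inr _ (F_ A) B])
    (p := [the {linear _ -> _} of @oplus_snd _ (F_ A) B])).
  by [].
split=> //; last by move/pure_projective_mittag_leffler.
split=> //; apply: direct_limits_oplus B_limit => [p|i]; last exact: (XA i).1.
by exists p.1.
Qed.
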